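(* Let $n \geq 5$. Then $\tilde{H}_i(\mathcal{VR}(\mathbb{I}_n;3);\mathbb{Z}) \neq 0$ if and only if $i \in \{4,7\}$.
   Context: For $n\ge 1$, $\mathbb{I}_n$ is the $n$-dimensional hypercube graph: its vertex set is $\{0,1\}^n$ and two vertices are adjacent iff they differ in exactly one coordinate. It is regarded as a metric space with the shortest-path distance, which equals the Hamming distance $d(v,w)=\#\{i : v(i)\neq w(i)\}$, where $v(i)$ denotes the $i$-th coordinate of $v$. For a metric space $(X,d)$ and $r\ge 0$, the Vietoris–Rips complex $\mathcal{VR}(X;r)$ is the simplicial complex on vertex set $X$ whose simplices are the finite subsets $\sigma\subseteq X$ with $d(x,y)\le r$ for all $x,y\in\sigma$. $\tilde H_i$ denotes reduced simplicial homology. *)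

(* Defs.v *)
From mathcomp Require Import all_boot all_order all_algebra.
Set Implicit Arguments. Unset Strict Implicit. Unset Printing Implicit Defensive.
Import GRing.Theory Num.Theory.
Local Open Scope ring_scope.

(* The hypercube graph I_n: vertices {0,1}^n, Hamming (= shortest path) distance. *)
Definition cube (n : nat) : finType := {ffun 'I_n -> bool}.
Definition hamming (n : nat) (v w : cube n) : nat := #|[set i | v i != w i]|.

Section VR.
Variables (X : finType) (d : X -> X -> nat) (r : nat).

(* Simplices of VR(X;r): finite subsets of pairwise distance <= r
   (the empty set is the (-1)-simplex, giving the augmented complex). *)
Definition vr_simplex (s : {set X}) : bool :=
  [forall x in s, forall y in s, (d x y <= r)%N].

(* Integer k-chains, k = number of vertices = dimension + 1: integer
   combinations of simplices with k vertices. *)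
Definition is_chain (k : nat) (c : {ffun {set X} -> int}) : Prop :=
  forall s, c s != 0 -> vr_simplex s && (#|s| == k)%N.

Definition face_sign (s : {set X}) (v : X) : int :=
  (-1) ^+ #|[set w in s | (enum_rank w < enum_rank v)%N]|.

Definition boundary (c : {ffun {set X} -> int}) : {ffun {set X} -> int} :=
  [ffun t => \sum_(s : {set X}) \sum_(v in s | t == s :\ v) face_sign s v * c s].

Definition reduced_homology_nonzero (i : nat) : Prop :=
  exists z, [/\ is_chain i.+1 z, boundary z = 0 &
     ~ exists b, is_chain i.+2 b /\ boundary b = z].
End VR.

(* Main.v *)
Require Import Defs.
From mathcomp Require Import all_boot all_order all_algebra.
From mathcomp Require Import zify ring.
Set Implicit Arguments. Unset Strict Implicit. Unset Printing Implicit Defensive.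
Import GRing.Theory Num.Theory.

(** Call a coordinate varying on a set S of vertices if S takes both values there, and
    filter all finite sets of vertices by their number of varying coordinates.
    - The cliques (sets of diameter at most 3) with at least 5 varying coordinates form
      an acyclic relative complex, because they can be matched by toggling a point u:
      if the even part E of S has at least two points, u is an odd point of the box
      spanned by two or three points of E; otherwise the odd part of S lies on the
      sphere of radius 1 around a unique point w, and u is w or a neighbor of w.
    - The sets spanning a given m-dimensional subcube form a relative complex with
      homology only in degree m, so the complex Y of all sets with at most 4 varying
      coordinates has reduced homology only in degree 4.
    - The non-cliques in Y span 4-dimensional subcubes and contain antipodal points;
      their relative homology lives in degree 8.
    Hence the reduced homology of VR vanishes outside degrees 4 and 7, and it can be
    computed with the cliques in Y.  The 7-dimensional cross-polytope on the vertices of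
    a 4-subcube does not bound, since Y contains no clique with 9 vertices.  The
    boundary of a 5-subcube, pushed into the cliques of Y, does not bound, since chains
    in Y have degree zero over the 5-subcube. *)

(** * Relative homology of families of finite sets *)

Section Chains.
Local Open Scope ring_scope.
Variable X : finType.
Implicit Types (s t : {set X}) (v w x : X) (b c z : {ffun {set X} -> int}).
Implicit Types (F A B : {set {set X}}) (k : nat).

Lemma sign_setU1 t v : face_sign (v |: t) v = face_sign t v.
Proof.
congr (_ ^+ _); apply: eq_card => u; rewrite !inE.
by case: eqVneq => //= ->; rewrite ltnn andbF.
Qed.

Lemma sign_setU1_neq t v w : w \notin t ->
  face_sign (w |: t) v = (-1) ^+ (enum_rank w < enum_rank v)%N * face_sign t v.
Proof.
move=> wt; rewrite /face_sign -exprD; congr (_ ^+ _).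
have [lt|ge] := boolP (enum_rank w < enum_rank v)%N; last first.
  apply: eq_card => u; rewrite !inE; case: eqVneq => //= ->.
  by rewrite (negPf ge) (negPf wt).
set B := [set u in t | _]; have wB : w \notin B by rewrite inE (negPf wt).
transitivity #|w |: B|; last by rewrite cardsU1 wB.
by apply: eq_card => u; rewrite !inE; case: eqVneq => //= ->; rewrite lt.
Qed.

Lemma sign_sqr t v : face_sign t v * face_sign t v = 1.
Proof. by rewrite /face_sign -expr2 sqrr_sign. Qed.

Lemma sign_swap v w : v != w ->
  (-1) ^+ (enum_rank w < enum_rank v)%N = - (-1) ^+ (enum_rank v < enum_rank w)%N :> int.
Proof.
move=> vw; have : enum_rank v != enum_rank w :> nat by rewrite (inj_eq val_inj) (inj_eq enum_rank_inj).
by case: ltngtP.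
Qed.

Lemma chainDE b c t : (b + c) t = b t + c t. Proof. by rewrite ffunE. Qed.
Lemma chainNE c t : (- c) t = - c t. Proof. by rewrite ffunE. Qed.
Lemma chain0E t : (0 : {ffun {set X} -> int}) t = 0. Proof. by rewrite ffunE. Qed.

Lemma boundaryE c t :
  boundary c t = \sum_(v | v \notin t) face_sign t v * c (v |: t).
Proof.
rewrite ffunE (exchange_big_dep xpredT) //= [RHS]big_mkcond /=.
apply: eq_bigr => v _; case: ifP => vt.
  rewrite (big_pred1 (v |: t)) ?sign_setU1 // => s; rewrite /=.
  apply/andP/eqP => [[vs /eqP ->]|->]; first by rewrite setD1K.
  by rewrite setU11 setU1K.
rewrite big1 // => s /andP[_ /eqP ts]; by rewrite ts setD11 in vt.
Qed.

Lemma boundaryD b c : boundary (b + c) = boundary b + boundary c.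
Proof.
apply/ffunP => t; rewrite chainDE !boundaryE -big_split /=.
by apply: eq_bigr => v _; rewrite ffunE mulrDr.
Qed.

Lemma boundaryN c : boundary (- c) = - boundary c.
Proof.
apply/ffunP => t; rewrite chainNE !boundaryE -sumrN.
by apply: eq_bigr => v _; rewrite ffunE mulrN.
Qed.

Lemma boundaryB b c : boundary (b - c) = boundary b - boundary c.
Proof. by rewrite boundaryD boundaryN. Qed.

Lemma boundary0 : boundary 0 = 0 :> {ffun {set X} -> int}.
Proof. by apply/ffunP => t; rewrite boundaryE big1 ?ffunE // => v _; rewrite ffunE mulr0. Qed.

Lemma boundary_boundary c : boundary (boundary c) = 0.
Proof.
apply/ffunP => t; rewrite boundaryE chain0E.
pose G v w := if (v \notin t) && (w \notin t) && (v != w) then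
   face_sign t v * (face_sign (v |: t) w * c (w |: (v |: t))) else 0.
have -> : \sum_(v | v \notin t) face_sign t v * boundary c (v |: t) = \sum_v \sum_w G v w.
  rewrite big_mkcond; apply: eq_bigr => v _; rewrite /G; case: (boolP (v \in t)) => vt /=.
    by rewrite big1.
  rewrite boundaryE mulr_sumr big_mkcond; apply: eq_bigr => w _.
  by rewrite !inE negb_or eq_sym andbC.
have GN v w : G v w = - G w v.
  rewrite /G eq_sym [(_ \notin t) && _]andbC; case: ifP; last by rewrite oppr0.
  move=> /andP[/andP[wt vt] wv]; rewrite !sign_setU1_neq // (sign_swap wv).
  by rewrite setUCA; ring.
(* The double sum is antisymmetric in the order in which [v] and [w] are added, so it equals its own
   negative. *)
set u := (X in X = 0); suff : u = - u by lia.
rewrite {1}/u exchange_big /= /u -sumrN; apply: eq_bigr => v _; rewrite -sumrN.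
by apply: eq_bigr => w _.
Qed.

(** The contracting homotopy of the full simplex; terms of [c] that already contain [x] are
    dropped. *)
Definition cone x c : {ffun {set X} -> int} :=
  [ffun s : {set X} => if x \in s then face_sign s x * c (s :\ x) else 0].

Lemma boundary_cone x c : boundary (cone x c) = c - cone x (boundary c).
Proof.
apply/ffunP => t; rewrite boundaryE chainDE chainNE [cone _ _ t]ffunE; have [xt|xt] := boolP (x \in t); last first.
  rewrite oppr0 addr0 (bigD1 x) //= ffunE setU11 setU1K // sign_setU1 mulrA sign_sqr mul1r.
  rewrite big1 ?addr0 // => v /andP[_ vx].
  by rewrite ffunE !inE eq_sym (negPf vx) (negPf xt) mulr0.
have [u xu ->] : exists2 u : {set X}, x \notin u & t = x |: u by exists (t :\ x); rewrite ?setD11 ?setD1K.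
rewrite setU1K // sign_setU1 boundaryE [in RHS](bigD1 x) //= mulrDr mulrA sign_sqr mul1r.
rewrite opprD addNKr mulr_sumr -sumrN; apply: eq_big => v.
  by rewrite !inE negb_or andbC.
rewrite !inE negb_or => /andP[vx vu]; rewrite ffunE !inE eqxx orbT.
have -> : (v |: (x |: u)) :\ x = v |: u.
  by apply/setP => y; rewrite !inE; case: (eqVneq y x) => //= ->; rewrite (negPf xu) eq_sym (negPf vx).
rewrite (sign_setU1_neq v xu) setUCA sign_setU1 (sign_setU1_neq x vu) (sign_swap vx); case: (_ < _)%N; ring.
Qed.

(** [k] counts vertices, so these chains have dimension [k - 1], and [k = 0] is the augmentation
    degree. *)
Definition on F k c := forall s, c s != 0 -> (s \in F) && (#|s| == k).

Definition restrict F c : {ffun {set X} -> int} := [ffun s : {set X} => if s \in F then c s else 0].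

Lemma restrictE F c s : restrict F c s = if s \in F then c s else 0.
Proof. by rewrite ffunE. Qed.

(** Vanishing of relative homology at sets of [k] vertices: [F] stands for a quotient of complexes,
    so boundaries are tested only at members of [F]. *)
Definition acyclic F k := forall z, on F k z -> (forall t, t \in F -> boundary z t = 0) ->
  exists2 b, on F k.+1 b & forall t, t \in F -> boundary b t = z t.

(** Only intervals of length two are constrained, which is what the truncated boundary needs to
    square to zero. *)
Definition convex F := forall s v w, s \in F -> s :\ v :\ w \in F -> s :\ v \in F.

(* [A] is closed under passing to faces that lie in [A :|: B]. *)
Definition lower A B := forall s v, s \in A -> s :\ v \notin B.

Lemma onD F k b c : on F k b -> on F k c -> on F k (b + c).
Proof.
move=> hb hc s; rewrite ffunE; have [->|/hb //] := eqVneq (b s) 0.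
by rewrite add0r => /hc.
Qed.

Lemma onN F k c : on F k c -> on F k (- c).
Proof. by move=> hc s; rewrite ffunE oppr_eq0 => /hc. Qed.

Lemma onB F k b c : on F k b -> on F k c -> on F k (b - c).
Proof. by move=> hb hc; apply: onD => //; apply: onN. Qed.

Lemma on_sub F F' k c : {subset F <= F'} -> on F k c -> on F' k c.
Proof. by move=> sF hc s /hc /andP[/sF -> ->]. Qed.

Lemma on_restrict F F' k c : on F k c -> on F' k (restrict F' c).
Proof. by move=> hc s; rewrite restrictE; case: ifP => _; rewrite ?eqxx // => /hc /andP[]. Qed.

Lemma on_out F k c s : on F k c -> s \notin F -> c s = 0.
Proof. by move=> hc sF; apply/eqP/negPn/negP => /hc /andP[]; rewrite (negPf sF). Qed.

Lemma boundary_supp c t : boundary c t != 0 -> exists2 v, v \notin t & c (v |: t) != 0.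
Proof.
rewrite boundaryE => h; apply/exists_inP; apply: contraNT h => /exists_inPn hv.
by rewrite big1 // => v /hv /negPn/eqP ->; rewrite mulr0.
Qed.

Lemma on_boundary F F' k c : on F k.+1 c -> on F' k (restrict F' (boundary c)).
Proof.
move=> hc s; rewrite restrictE; case: ifP => _; rewrite ?eqxx //.
by move=> /boundary_supp [v vs /hc]; rewrite cardsU1 vs => /andP[].
Qed.

Lemma eq_boundary_at b c t :
  (forall v, v \notin t -> b (v |: t) = c (v |: t)) -> boundary b t = boundary c t.
Proof. by move=> h; rewrite !boundaryE; apply: eq_bigr => v vt; rewrite h. Qed.

Lemma boundary_restrict F k c t : convex F -> on F k c -> t \in F ->
  boundary (restrict F (boundary c)) t = 0.
Proof.
move=> cF hc tF; transitivity (boundary (boundary c) t); last by rewrite boundary_boundary chain0E.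
apply: eq_boundary_at => v vt; rewrite restrictE; case: ifPn => // vtF.
apply/esym/eqP/negPn/negP => /boundary_supp [w wt /hc /andP[wtF _]].
have := cF _ w v wtF; rewrite (setU1K wt) (setU1K vt) => /(_ tF).
by rewrite (negPf vtF).
Qed.

Lemma boundary_lower A B k c t : lower A B -> on A k c -> t \in B -> boundary c t = 0.
Proof.
move=> lAB hc tB; apply/eqP/negPn/negP => /boundary_supp [v vt /hc /andP[vA _]].
by have := lAB _ v vA; rewrite setU1K // tB.
Qed.

Section LongExactSequence.
Variables (F A B : {set {set X}}).
Hypotheses (cF : convex F) (FAB : F = A :|: B) (dAB : [disjoint A & B]) (lAB : lower A B).

Let inF s : (s \in F) = (s \in A) || (s \in B).
Proof. by rewrite FAB inE. Qed.

Let AF : {subset A <= F}. Proof. by move=> s sA; rewrite inF sA. Qed.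
Let BF : {subset B <= F}. Proof. by move=> s sA; rewrite inF sA orbT. Qed.
Let AnB s : s \in A -> s \notin B. Proof. by move=> sA; rewrite (disjointFr dAB). Qed.
Let BnA s : s \in B -> s \notin A. Proof. by move=> sA; rewrite (disjointFl dAB). Qed.

Lemma boundary_restrict_upper k c t : on F k c -> t \in B ->
  boundary (restrict B c) t = boundary c t.
Proof.
move=> hc tB; apply: eq_boundary_at => v vt; rewrite restrictE; case: ifPn => // nB.
have [vA|nA] := boolP (v |: t \in A); first by have := lAB v vA; rewrite setU1K // tB.
by rewrite (on_out hc) // inF negb_or nA.
Qed.

Lemma on_lower k c : on F k c -> (forall s, s \in B -> c s = 0) -> on A k c.
Proof.
move=> hc h s cs; have /andP[] := hc _ cs; rewrite inF => /orP[-> //|sB _].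
by rewrite h ?eqxx in cs.
Qed.

(** In this and the next two lemmas [A] is the subcomplex, [B] the quotient, and a piece of the long
    exact sequence is chased. Here the [B]-part of [z] is filled, the boundary of the filling is
    subtracted, and the rest is a cycle in [A]. *)
Lemma acyclic_ext k : acyclic A k -> acyclic B k -> acyclic F k.
Proof.
move=> hA hB z zF z0.
have [||bB onB_ bBE] := hB (restrict B z).
- exact: on_restrict zF.
- by move=> t tB; rewrite (boundary_restrict_upper zF) // z0 // BF.
have onBF := on_sub BF onB_.
have onz' : on A k (z - restrict F (boundary bB)).
  apply: on_lower => [|s sB]; first by apply: onB => //; apply: on_boundary onBF.
  by rewrite chainDE chainNE !restrictE (BF sB) bBE // restrictE sB subrr.
have [|bA onA_ bAE] := hA _ onz'.
  move=> t tA; rewrite boundaryB chainDE chainNE z0 ?AF //.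
  by rewrite (boundary_restrict cF onBF) ?AF // subrr.
exists (bA + bB); first by apply: onD => //; apply: on_sub AF onA_.
move=> t tF; rewrite boundaryD chainDE; move: tF; rewrite inF => /orP[tA|tB].
  by rewrite bAE // chainDE chainNE !restrictE AF // subrK.
by rewrite (boundary_lower lAB onA_) // add0r bBE // restrictE tB.
Qed.

(** The boundary of a relative cycle in [B] is a cycle in [A]; filling it corrects [z] to a cycle in
    [F], whose filling is then cut down to [B]. *)
Lemma acyclic_quot k : acyclic F k.+1 -> acyclic A k -> acyclic B k.+1.
Proof.
move=> hF hA z zB z0; have zF := on_sub BF zB.
have [||c onc cE] := hA (restrict F (boundary z)).
- apply: on_lower => [|s sB]; first exact: on_boundary zF.
  by rewrite restrictE BF // z0.
- by move=> t tA; rewrite (boundary_restrict cF zF) ?AF.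
have [||b onb bE] := hF (z - c).
- by apply: onB => //; apply: on_sub AF onc.
- move=> t; rewrite boundaryB chainDE chainNE inF => /orP[tA|tB].
    by rewrite cE // restrictE AF // subrr.
  by rewrite z0 // (boundary_lower lAB onc) // subrr.
exists (restrict B b); first exact: on_restrict onb.
move=> t tB; rewrite (boundary_restrict_upper onb) // bE ?BF // chainDE chainNE.
by rewrite (on_out onc) ?BnA // subr0.
Qed.

(** A filling of [z] in [F] has a [B]-part that is a relative cycle; subtracting the boundary of a
    filling of that part moves everything into [A]. *)
Lemma acyclic_sub k : acyclic B k.+1 -> acyclic F k -> acyclic A k.
Proof.
move=> hB hF z zA z0; have zF := on_sub AF zA.
have [|b onb bE] := hF z zF.
  move=> t; rewrite inF => /orP[/z0 //|tB]; exact: boundary_lower lAB zA tB.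
have [||c onc cE] := hB (restrict B b).
- exact: on_restrict onb.
- move=> t tB; rewrite (boundary_restrict_upper onb) // bE ?BF //.
  by rewrite (on_out zA) ?BnA.
have oncF := on_sub BF onc.
exists (b - restrict F (boundary c)).
  apply: on_lower => [|s sB]; first by apply: onB => //; apply: on_boundary oncF.
  by rewrite chainDE chainNE !restrictE BF // cE // restrictE sB subrr.
move=> t tA; rewrite boundaryB chainDE chainNE bE ?AF //.
by rewrite (boundary_restrict cF oncF) ?AF // subr0.
Qed.

End LongExactSequence.

Lemma acyclic_card F k : (forall s, s \in F -> #|s| != k) -> acyclic F k.
Proof.
move=> hF z zF _; exists 0; first by move=> s; rewrite ffunE eqxx.
move=> t _; rewrite boundary0 ffunE; apply/esym/eqP/negPn/negP => /zF /andP[/hF].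
by move=> /negPf ->.
Qed.

Lemma acyclic_set0 k : acyclic set0 k.
Proof. by apply: acyclic_card => s; rewrite inE. Qed.

(** Pairing [s :\ x] with [x |: s] never leaves the family, so the cone with apex [x] contracts
    it. *)
Lemma acyclic_toggle F x k :
  (forall s, s \in F -> (x |: s \in F) && (s :\ x \in F)) -> acyclic F k.
Proof.
move=> hF z zF z0; exists (cone x z).
  move=> s; rewrite ffunE; case: ifP => xs; rewrite ?eqxx // mulf_eq0 negb_or => /andP[_ /zF].
  by move=> /andP[/hF]; rewrite setD1K // => /andP[-> _] /eqP <-; rewrite (cardsD1 x s) xs /=.
move=> t tF; rewrite boundary_cone chainDE chainNE ffunE; case: ifP => xt; last by rewrite subr0.
by rewrite z0 ?mulr0 ?subr0 //; case/andP: (hF t tF).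
Qed.

Section Filter.
Variables (F : {set {set X}}) (L : eqType) (lab : {set X} -> L) (rk : L -> nat).
Hypothesis cF : convex F.
Hypothesis mono : forall s v, s \in F -> s :\ v \in F ->
  (rk (lab (s :\ v)) < rk (lab s))%N \/ lab (s :\ v) = lab s.

Lemma mono_le s v : s \in F -> s :\ v \in F -> (rk (lab (s :\ v)) <= rk (lab s))%N.
Proof. by move=> sF svF; case: (mono sF svF) => [/ltnW|->]. Qed.

(** Ranks do not increase along faces, so a set between two members of a fiber has their rank, and
    [mono] then forces their label. *)
Lemma convex_fiber l : convex [set s in F | lab s == l].
Proof.
move=> s v w; rewrite !inE => /andP[sF /eqP sl] /andP[swF /eqP swl].
have svF := cF sF swF; rewrite svF /=; apply/eqP.
case: (mono svF swF) => [lt|<- //]; have := mono_le sF svF.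
by rewrite leqNgt sl -swl lt.
Qed.

End Filter.

(** Induction on the size of [F], splitting off one fiber at a time with [acyclic_ext]. *)
Lemma acyclic_filter F (L : eqType) (lab : {set X} -> L) (rk : L -> nat) k :
  convex F ->
  (forall s v, s \in F -> s :\ v \in F ->
     (rk (lab (s :\ v)) < rk (lab s))%N \/ lab (s :\ v) = lab s) ->
  (forall l, acyclic [set s in F | lab s == l] k) -> acyclic F k.
Proof.
have [m] := ubnP #|F|; elim: m F => // m IH F cardF cF mono hl.
have [->|[s0 s0F]] := set_0Vmem F; first exact: acyclic_set0.
(* A label of maximal rank: no set with another label has a face carrying it, so its fiber is a
   quotient of the family. *)
pose s1 := [arg max_(s > s0 in F) rk (lab s)].
have [s1F s1max] : s1 \in F /\ forall s, s \in F -> (rk (lab s) <= rk (lab s1))%N.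
  by rewrite /s1; case: arg_maxnP.
pose B := [set s in F | lab s == lab s1]; pose A := [set s in F | lab s != lab s1].
have lAB : lower A B.
  move=> s v; rewrite !inE => /andP[sF ls]; apply/negP => /andP[svF /eqP lsv].
  have := s1max _ sF; rewrite -lsv leqNgt.
  by case: (mono _ _ sF svF) => [-> //|]; rewrite lsv => /esym/eqP; rewrite (negPf ls).
apply: (@acyclic_ext F A B) => //.
- by apply/setP => s; rewrite !inE; case: (s \in F); case: eqP.
2: exact: hl.
apply: IH.
- apply: leq_trans (_ : #|F| <= m)%N; last by rewrite -ltnS.
  apply: proper_card; apply/properP; split; first by apply/subsetP => s; rewrite inE => /andP[].
  by exists s1 => //; rewrite inE eqxx andbF.
- move=> s v w sA swA; have svF : s :\ v \in F.
    by move: sA swA; rewrite !inE => /andP[? _] /andP[? _]; apply: cF; eauto.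
  by have := lAB s v sA; move: sA; rewrite !inE svF /= => _ ->.
- move=> s v; rewrite !inE => /andP[sF _] /andP[svF _]; exact: mono.
move=> l; have [->|nl] := eqVneq l (lab s1).
  rewrite (_ : [set s in A | _] = set0); first exact: acyclic_set0.
  by apply/setP => s; rewrite !inE; case: eqP; rewrite ?andbF.
rewrite (_ : [set s in A | _] = [set s in F | lab s == l]) //.
by apply/setP => s; rewrite !inE; case: (lab s =P l) => [->|]; rewrite ?andbF ?andbT // nl andbT.
Qed.

End Chains.

(** * Counting coordinates by pattern *)

Section PatternCounting.
Variable n : nat.

Lemma card_bit (I : finType) (q : pred I) (g : bool -> pred I) :
  #|[set i | g (q i) i]| = #|[set i | q i && g true i]| + #|[set i | ~~ q i && g false i]|.
Proof.
rewrite -(cardsID [set i | q i]); congr addn; apply: eq_card => i; rewrite !inE.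
  by case: (q i); rewrite ?andbT ?andbF.
by case: (q i).
Qed.

Definition pattern_sum (N : bool -> bool -> bool -> bool -> bool -> nat)
    (g : bool -> bool -> bool -> bool -> bool -> bool) : nat :=
  let sum (h : bool -> nat) := h true + h false in
  sum (fun a => sum (fun b => sum (fun c => sum (fun d => sum (fun e =>
    if g a b c d e then N a b c d e else 0))))).

Section Points.
Variables x y z o s u : cube n.

(** The point [x] serves as origin: [f] sees only the differences from [x], so it may describe any
    bitwise operation compatible with flipping coordinates, such as a majority. *)
Definition gate (p : cube n) (f : bool -> bool -> bool -> bool -> bool -> bool) :=
  forall i, p i = x i (+) f (x i (+) y i) (x i (+) z i) (x i (+) o i) (x i (+) s i) (x i (+) u i).

(* [N a b c d e] counts the coordinates in which [y, z, o, s, u] differ from [x]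
   according to the pattern [a, b, c, d, e]; distances between points obtained from
   these six by a bitwise gate become sums of the [N a b c d e], whence every
   metric statement about six points becomes linear arithmetic. *)
Lemma card_patterns : exists N,
  [/\ forall g (P : pred 'I_n),
        (forall i, P i = g (x i (+) y i) (x i (+) z i) (x i (+) o i) (x i (+) s i) (x i (+) u i)) ->
        #|[set i | P i]| = pattern_sum N g,
      forall p q f g, gate p f -> gate q g ->
        hamming p q = pattern_sum N (fun a b c d e => f a b c d e (+) g a b c d e)
    & forall i, 0 < N (x i (+) y i) (x i (+) z i) (x i (+) o i) (x i (+) s i) (x i (+) u i)].
Proof.
pose N a b c d e := #|[set i | [&& x i (+) y i == a, x i (+) z i == b, x i (+) o i == c,
  x i (+) s i == d & x i (+) u i == e]]|.
have cardN g (P : pred 'I_n) :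
  (forall i, P i = g (x i (+) y i) (x i (+) z i) (x i (+) o i) (x i (+) s i) (x i (+) u i)) ->
  #|[set i | P i]| = pattern_sum N g; last first.
  exists N; split=> // [p q f g fp gq|i]; last by apply/card_gt0P; exists i; rewrite inE !eqxx.
  by apply: cardN => i; rewrite fp gq; case: (x i); case: (f _ _ _ _ _); case: (g _ _ _ _ _).
move=> gP.
rewrite (eq_card (B := [set i | g (x i (+) y i) (x i (+) z i) (x i (+) o i) (x i (+) s i) (x i (+) u i)])); last first.
  by move=> i; rewrite !inE gP.
have const (Q : pred 'I_n) b : #|[set i | Q i && b]| = if b then #|[set i | Q i]| else 0.
  by case: b; [apply: eq_card => i|apply: eq_card0 => i]; rewrite !inE ?andbT ?andbF.
rewrite (card_bit (fun i => x i (+) y i) (fun a i => g a _ _ _ _)) /pattern_sum.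
congr addn; rewrite (card_bit (fun i => x i (+) z i) (fun a i => _ && g _ a _ _ _));
congr addn; rewrite (card_bit (fun i => x i (+) o i) (fun a i => _ && (_ && g _ _ a _ _)));
congr addn; rewrite (card_bit (fun i => x i (+) s i) (fun a i => _ && (_ && (_ && g _ _ _ a _))));
congr addn; rewrite (card_bit (fun i => x i (+) u i) (fun a i => _ && (_ && (_ && (_ && g _ _ _ _ a)))));
congr addn; rewrite -const; apply: eq_card => i; rewrite !inE;
case: (x i (+) y i); case: (x i (+) z i); case: (x i (+) o i); case: (x i (+) s i);
case: (x i (+) u i); case: (g _ _ _ _ _); rewrite //=.
Qed.

Lemma gates :
  [/\ gate x (fun _ _ _ _ _ => false), gate y (fun a _ _ _ _ => a), gate z (fun _ a _ _ _ => a)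
    & [/\ gate o (fun _ _ a _ _ => a), gate s (fun _ _ _ a _ => a) & gate u (fun _ _ _ _ a => a)]].
Proof. by split; last split; move=> i; rewrite ?addbF // addKb. Qed.

End Points.
End PatternCounting.

Ltac bits i :=
  rewrite ?ffunE; repeat match goal with |- context [fun_of_fin ?p i] => case: (fun_of_fin p i) end.

(** Statements about fewer than six points repeat arguments; only one gate per point is kept, so
    that all its distances are expanded consistently. *)
Ltac patterns x y z o s u N cardN pos :=
  have [N [cardN hN pos]] := card_patterns x y z o s u;
  have [Gx Gy Gz [Go Gs Gu]] := gates x y z o s u;
  repeat match goal with
    G : gate _ _ _ _ _ _ ?p _, G' : gate _ _ _ _ _ _ ?p _ |- _ => clear G' end.

Ltac count_distances := repeat
  match goal with
  | hN : forall p q f g, _ -> _ -> hamming p q = _, Gp : gate _ _ _ _ _ _ ?p _,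
    Gq : gate _ _ _ _ _ _ ?q _, H : context [hamming ?p ?q] |- _ =>
      rewrite (hN p q _ _ Gp Gq) /pattern_sum /= in H
  | hN : forall p q f g, _ -> _ -> hamming p q = _, Gp : gate _ _ _ _ _ _ ?p _,
    Gq : gate _ _ _ _ _ _ ?q _ |- context [hamming ?p ?q] =>
      rewrite (hN p q _ _ Gp Gq) /pattern_sum /=
 end.

Notation rips := (vr_simplex (@hamming _) 3).

(** * Parity, varying coordinates and boxes in the Hamming metric *)

Section Geometry.
Variable n : nat.
Implicit Types (x y z o s u w : cube n) (S : {set cube n}).

Definition parity x : bool := odd (hamming [ffun=> false] x).

Lemma hammingxx x : hamming x x = 0.
Proof. by apply: eq_card0 => i; rewrite !inE eqxx. Qed.

Lemma hammingC x y : hamming x y = hamming y x.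
Proof. by apply: eq_card => i; rewrite !inE eq_sym. Qed.

Lemma hamming_eq0 x y : (hamming x y == 0) = (x == y).
Proof.
apply/idP/eqP => [|->]; last by rewrite hammingxx.
rewrite cards_eq0 => /eqP e; apply/ffunP => i; have := in_set0 i.
by rewrite -e inE => /negbFE/eqP.
Qed.

Lemma odd_hamming x y : odd (hamming x y) = parity x (+) parity y.
Proof.
patterns ([ffun=> false] : cube n) x y y y y N cardN pos; rewrite /parity; count_distances; lia.
Qed.

Lemma hamming_same_parity x y : x != y -> parity x = parity y -> hamming x y <= 3 -> hamming x y = 2.
Proof. by rewrite -hamming_eq0 => h p; have := odd_hamming x y; rewrite p addbb; lia. Qed.

Lemma hamming_same_parity_le2 x y : parity x = parity y -> hamming x y <= 3 -> hamming x y <= 2.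
Proof. by move=> p; have := odd_hamming x y; rewrite p addbb; lia. Qed.

Lemma hamming_triangle x y z : hamming x z <= hamming x y + hamming y z.
Proof. by patterns x y z z z z N cardN pos; count_distances; lia. Qed.

Definition varying S : {set 'I_n} := [set i | [exists x in S, x i] && [exists x in S, ~~ x i]].

Lemma varyingP S i :
  reflect (exists x y, [/\ x \in S, y \in S, x i & ~~ y i]) (i \in varying S).
Proof.
rewrite inE; apply: (iffP andP) => [[/exists_inP[x xS xi] /exists_inP[y yS yi]]|[x [y [xS yS xi yi]]]].
  by exists x, y.
by split; apply/exists_inP; [exists x|exists y].
Qed.

Lemma varyingS S S' : S \subset S' -> varying S \subset varying S'.
Proof.
move=> /subsetP sub; apply/subsetP => i /varyingP[x [y [/sub xS /sub yS xi yi]]].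
by apply/varyingP; exists x, y.
Qed.

(** Pigeonhole: some varying coordinate is not among those in which [ps] departs from [x]. For more
    than four varying coordinates this produces a point of [S] that leaves any configuration
    occupying at most four. *)
Lemma exists_outside S x (ps : seq (cube n)) :
  #|[set i | ~~ all (fun p : cube n => p i == x i) ps]| < #|varying S| ->
  exists s i, [/\ s \in S, all (fun p : cube n => p i == x i) ps & s i != x i].
Proof.
move=> lt; have /subsetPn[i iS] : ~~ (varying S \subset [set i | ~~ all (fun p : cube n => p i == x i) ps]).
  by apply: contraL lt => /subset_leq_card; rewrite -leqNgt.
rewrite inE negbK => ai; have /varyingP[y [y' [yS yS' yi yi']]] := iS.
case e : (x i); first by exists y', i; split; rewrite // e; case: (y' i) yi'.
by exists y, i; split; rewrite // e yi.
Qed.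

(** Membership of [u] in the box spanned by [S]. *)
Definition hull S u := forall i, exists2 s, s \in S & s i = u i.


Lemma ripsP S : reflect {in S &, forall x y, hamming x y <= 3} (rips S).
Proof.
by apply: (iffP forall_inP) => [h x y xS|h x xS]; [move/forall_inP: (h x xS); apply|apply/forall_inP => y; apply: h].
Qed.

Lemma ripsS S S' : S \subset S' -> rips S' -> rips S.
Proof. by move=> /subsetP sub /ripsP h; apply/ripsP => x y /sub xS /sub yS; apply: h. Qed.

Lemma varying_hull S u : hull (S :\ u) u -> varying (u |: S) = varying (S :\ u).
Proof.
move=> hu; apply/eqP; rewrite eqEsubset andbC varyingS ?(subset_trans (subD1set _ _)) ?subsetUr //=.
have mem v i : v \in u |: S -> exists2 s, s \in S :\ u & s i = v i.
  by rewrite !inE; case: eqVneq => [-> _|vu /= vS]; [apply: hu|exists v; rewrite // !inE vu].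
apply/subsetP => i /varyingP[x [y [/mem-/(_ i)[x' xS <-] /mem-/(_ i)[y' yS <-] xi yi]]].
by apply/varyingP; exists x', y'.
Qed.

(** A point in the box of the remaining ones does not affect which coordinates vary, so only the
    distances to [u] matter. *)
Lemma toggle_in S u m : rips S -> m < #|varying S| -> {in S, forall s, hamming u s <= 3} ->
  hull (S :\ u) u ->
  (rips (u |: S) && (m < #|varying (u |: S)|)) && (rips (S :\ u) && (m < #|varying (S :\ u)|)).
Proof.
move=> /ripsP rS lt hu hS.
have sub := subset_trans (subsetUr [set u] S) (subxx _).
have lt1 : m < #|varying (u |: S)| := leq_trans lt (subset_leq_card (varyingS sub)).
rewrite lt1 -varying_hull // lt1 !andbT; apply/andP; split; apply/ripsP => x y; last first.
  by rewrite !inE => /andP[_ xS] /andP[_ yS]; apply: rS.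
rewrite !inE => /predU1P[->|xS] /predU1P[->|yS]; rewrite ?hammingxx ?hu //; last exact: rS.
by rewrite hammingC hu.
Qed.

(** The coordinatewise majority. *)
Definition median x y z : cube n := [ffun i => if x i == y i then x i else z i].
Definition sum3 x y z : cube n := [ffun i => x i (+) y i (+) z i].
Definition between x y z u := [forall i, [|| u i == x i, u i == y i | u i == z i]].

(* Two points of [between x y z] differ only where [x, y, z] do not all agree. *)
Lemma hamming_between x y z u u' :
  hamming x y <= 2 -> hamming x z <= 2 -> hamming y z <= 2 ->
  between x y z u -> between x y z u' -> hamming u u' <= 3.
Proof.
move=> xy xz yz /forallP bu /forallP bu'.
have : hamming u u' <= #|[set i | (x i != y i) || (x i != z i)]|.
  apply/subset_leq_card/subsetP => i; rewrite !inE; move: (bu i) (bu' i).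
  by case: (x i); case: (y i); case: (z i); case: (u i); case: (u' i).
patterns x y z z z z N cardN pos.
rewrite (cardN (fun a b _ _ _ => a || b)) /pattern_sum /=; last by move=> i; bits i.
by count_distances; lia.
Qed.

(** By parity [x], [y], [z] are pairwise at distance 0 or 2, so a point of the other parity in their
    box is adjacent to one of them, and each of them is within 2 of [e]. *)
Lemma between_near x y z u e :
  hamming x y <= 3 -> hamming x z <= 3 -> hamming y z <= 3 ->
  hamming x e <= 3 -> hamming y e <= 3 -> hamming z e <= 3 ->
  parity y = parity x -> parity z = parity x -> parity e = parity x -> parity u = ~~ parity x ->
  between x y z u -> hamming u e <= 3.
Proof.
move=> xy xz yz xe ye ze py pz pe pu /forallP bu.
have : #|[set i | ~~ [|| u i == x i, u i == y i | u i == z i]]| = 0.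
  by apply: eq_card0 => i; rewrite !inE bu.
have := odd_hamming x y; have := odd_hamming x z; have := odd_hamming y z.
have := odd_hamming x e; have := odd_hamming x u.
rewrite py pz pe pu addbb addbN addbb /=.
patterns x y z u e e N cardN pos => o1 o2 o3 o4 o5.
rewrite (cardN (fun a b c _ _ => ~~ [|| ~~ c, a == c | b == c])) /pattern_sum /=; last by move=> i; bits i.
by count_distances; lia.
Qed.
End Geometry.

(** * Cliques with at least five varying coordinates *)

Section Cliques.
Variable n : nat.
Implicit Types (x y z o s u w : cube n).
(** Three points pairwise at distance 2 lie in a 3-cube, where the majority is adjacent to all
    three. *)
Lemma parity_median x y z : hamming x y = 2 -> hamming x z = 2 -> hamming y z = 2 ->
  parity (median x y z) = ~~ parity x.
Proof.
move=> xy xz yz; patterns x y z x x x N cardN pos.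
have Gv : gate x y z x x x (median x y z) (fun a b _ _ _ => a && b) by move=> i; bits i.
by have := odd_hamming x (median x y z); count_distances; lia.
Qed.

Lemma between_median x y z : between x y z (median x y z).
Proof. by apply/forallP => i; bits i. Qed.

Lemma between_sum3 x y z : between x y z (sum3 (median x y z) x y).
Proof. by apply/forallP => i; bits i. Qed.

Lemma parity_sum3 x y z : parity (sum3 x y z) = parity x (+) parity y (+) parity z.
Proof.
patterns ([ffun=> false] : cube n) x y z z z N cardN pos.
have Gv : gate ([ffun=> false] : cube n) x y z z z (sum3 x y z) (fun a b c _ _ => a (+) b (+) c) by move=> i; bits i.
by rewrite /parity; count_distances; lia.
Qed.

Lemma center_unique s1 s2 s3 w w' :
  hamming s1 s2 = 2 -> hamming s1 s3 = 2 -> hamming s2 s3 = 2 ->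
  hamming w s1 = 1 -> hamming w s2 = 1 -> hamming w s3 = 1 ->
  hamming w' s1 = 1 -> hamming w' s2 = 1 -> hamming w' s3 = 1 -> w = w'.
Proof.
move=> s12 s13 s23 w1 w2 w3 w'1 w'2 w'3; apply/eqP; rewrite -hamming_eq0.
patterns s1 s2 s3 w w' w' N cardN pos; count_distances; lia.
Qed.

Variable S : {set cube n}.
Hypotheses (ripsS : rips S) (bigS : 4 < #|varying S|).

Let near x y : x \in S -> y \in S -> hamming x y <= 3.
Proof. by move/ripsP: ripsS; apply. Qed.

(** With [x] as origin, [y = {1,2}] and [z = {1,3}], the median is [{1}] and the sum is [{2}]. A far
    [o] has the form [{2,3,4}], a far [u] the form [{1,3,4}], and no point leaving these four
    coordinates is within 3 of all five. Since more than four coordinates vary, [S] contains such a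
    point. *)
Lemma near_sum3 x y z o : x \in S -> y \in S -> z \in S -> o \in S ->
  hamming x y = 2 -> hamming x z = 2 -> hamming y z = 2 ->
  parity o = ~~ parity x -> 3 < hamming (median x y z) o ->
  forall u, u \in S -> parity u = ~~ parity x -> hamming (sum3 (median x y z) x y) u <= 3.
Proof.
move=> xS yS zS oS xy xz yz po far u uS pu.
have [s [i [sS e si]]] : exists s i, [/\ s \in S,
    all (fun p : cube n => p i == x i) [:: y; z; o] & s i != x i].
  apply: exists_outside; apply: leq_trans bigS; rewrite ltnS.
  have := near xS oS; have := near yS oS; have := near zS oS.
  have := odd_hamming x o; rewrite po addbN addbb.
  patterns x y z o x x N cardN pos.
  have Gv : gate x y z o x x (median x y z) (fun a b _ _ _ => a && b) by move=> i; bits i.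
  rewrite (cardN (fun a b c _ _ => [|| a, b | c])) /pattern_sum /=; last by move=> i; bits i.
  by move: bigS po => _ _; count_distances; lia.
have {e} [ei1 ei2 ei3] : [/\ y i = x i, z i = x i & o i = x i].
  by case/and4P: e => /eqP -> /eqP -> /eqP ->.
have := near xS oS; have := near yS oS; have := near zS oS.
have := near xS sS; have := near yS sS; have := near zS sS; have := near oS sS.
have := near xS uS; have := near yS uS; have := near zS uS; have := near oS uS; have := near sS uS.
have := odd_hamming x o; have := odd_hamming x u; rewrite po pu addbN addbb.
patterns x y z o s u N cardN pos.
have Gv : gate x y z o s u (median x y z) (fun a b _ _ _ => a && b) by move=> j; bits j.
have Gt : gate x y z o s u (sum3 (median x y z) x y) (fun a b _ _ _ => a && ~~ b).
  by move=> j; bits j.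
have := pos i; rewrite ei1 ei2 ei3 addbb; have -> : x i (+) s i by move: si; case: (x i); case: (s i).
by case: (_ (+) _) => pi; move: po pu ei1 ei2 ei3 si bigS => _ _ _ _ _ _ _; count_distances; lia.
Qed.

(* For two points at distance 2, [h] and [x + y + h] are the two points adjacent to both. *)
Lemma near_common_neighbor x y h o o' : x \in S -> y \in S -> o \in S -> o' \in S ->
  hamming x y = 2 -> hamming x h = 1 -> hamming y h = 1 ->
  parity o = ~~ parity x -> parity o' = ~~ parity x ->
  3 < hamming h o -> 3 < hamming (sum3 x y h) o' -> False.
Proof.
move=> xS yS oS o'S xy xh yh po po' far far'.
have := odd_hamming x o; have := odd_hamming x o'; rewrite po po' addbN addbb => odd1 odd2.
have [s [i [sS e si]]] : exists s i, [/\ s \in S,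
    all (fun p : cube n => p i == x i) [:: y; o; o'] & s i != x i].
  apply: exists_outside; apply: leq_trans bigS; rewrite ltnS.
  have := near xS oS; have := near yS oS; have := near oS o'S.
  have := near xS o'S; have := near yS o'S.
  patterns x y o o' h x N cardN pos.
  have Gt : gate x y o o' h x (sum3 x y h) (fun a _ _ b _ => a (+) b) by move=> j; bits j.
  rewrite (cardN (fun a b c _ _ => [|| a, b | c])) /pattern_sum /=; last by move=> j; bits j.
  by move: bigS po => _ _; count_distances; lia.
have {e} [ei1 ei2 ei3] : [/\ y i = x i, o i = x i & o' i = x i].
  by case/and4P: e => /eqP -> /eqP -> /eqP ->.
have := near xS oS; have := near yS oS; have := near oS o'S.
have := near xS o'S; have := near yS o'S.
have := near xS sS; have := near yS sS; have := near oS sS; have := near o'S sS.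
patterns x y o o' h s N cardN pos.
have Gt : gate x y o o' h s (sum3 x y h) (fun a _ _ b _ => a (+) b) by move=> j; bits j.
have := pos i; rewrite ei1 ei2 ei3 addbb; have -> : x i (+) s i by move: si; case: (x i); case: (s i).
by case: (_ (+) _) => pi; move: po po' ei1 ei2 ei3 si bigS => _ _ _ _ _ _ _; count_distances; lia.
Qed.

(** The exceptional [y] is the even point if there is one, and an arbitrary point otherwise. *)
Lemma at_most_one_even : #|[set x in S | ~~ parity x]| <= 1 ->
  exists2 y, y \in S & forall t, t \in S -> t != y -> parity t.
Proof.
move=> /card_le1_eqP; set E := [set x in S | _] => cE.
have [y0 y0S] : exists y, y \in S.
  apply/set0Pn; apply: contraTneq bigS => ->; rewrite -leqNgt.
  rewrite (_ : varying set0 = set0) ?cards0 //; apply/setP => i; rewrite [RHS]inE.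
  by apply/varyingP => -[x [y []]]; rewrite inE.
have [E0|[y yE]] := set_0Vmem E.
  exists y0 => // t tS _; apply/negPn/negP => pt.
  by have := in_set0 t; rewrite -E0 inE tS pt.
exists y => [|t tS]; first by move: yE; rewrite inE => /andP[].
apply: contraNT => pt; apply/eqP/cE => //; by rewrite inE tS.
Qed.

(** Each new point differs from [y] in a coordinate where the earlier ones agree with [y]. The
    points are therefore distinct, and equal parity in a clique forces distance 2. *)
Lemma three_odd y : y \in S -> (forall t, t \in S -> t != y -> parity t) ->
  exists s1 s2 s3, [/\ s1 \in S, s2 \in S & s3 \in S] /\ [/\ parity s1, parity s2, parity s3 &
    [/\ hamming s1 s2 = 2, hamming s1 s3 = 2 & hamming s2 s3 = 2]].
Proof.
move=> yS oddS.
have neq (s t : cube n) i : s i != t i -> s != t by apply: contraNneq => ->.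
have [s1 [i1 [s1S _ n1]]] : exists s i, [/\ s \in S, all (fun p : cube n => p i == y i) [::] & s i != y i].
  by apply: exists_outside; rewrite (_ : [set _ | _] = set0) ?cards0 ?(leq_trans _ bigS) //; apply/setP=> i; rewrite !inE.
have p1 := oddS _ s1S (neq _ _ _ n1).
have [s2 [i2 [s2S e2 n2]]] : exists s i, [/\ s \in S, all (fun p : cube n => p i == y i) [:: s1] & s i != y i].
  apply: exists_outside; apply: leq_trans bigS; rewrite ltnS; apply: leq_trans (_ : 3 <= 4) => //.
  apply: leq_trans (near yS s1S); apply/subset_leq_card/subsetP => i; rewrite !inE /= andbT.
  by rewrite eq_sym.
have p2 := oddS _ s2S (neq _ _ _ n2).
have s12 : hamming s1 s2 = 2.
  apply: hamming_same_parity; rewrite ?p1 ?p2 ?near // eq_sym; apply: (neq _ _ i2).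
  by move: e2; rewrite /= andbT => /eqP ->.
have [s3 [i3 [s3S e3 n3]]] : exists s i, [/\ s \in S, all (fun p : cube n => p i == y i) [:: s1; s2] & s i != y i].
  apply: exists_outside; apply: leq_trans bigS; rewrite ltnS.
  move: (near yS s1S) (near yS s2S) s12; patterns y s1 s2 y y y N cardN pos.
  rewrite (cardN (fun a b _ _ _ => a || b)) /pattern_sum /=; last by move=> i; bits i.
  by clear bigS p1 p2 n1 n2 e2; count_distances; lia.
have p3 := oddS _ s3S (neq _ _ _ n3).
have [e31 e32] : y i3 = s1 i3 /\ y i3 = s2 i3 by case/and3P: e3 => /eqP -> /eqP ->.
exists s1, s2, s3; split=> //; split=> //; split=> //; apply: hamming_same_parity; rewrite ?p1 ?p2 ?p3 ?near //.
  by rewrite eq_sym; apply: (neq _ _ i3); rewrite -e31.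
by rewrite eq_sym; apply: (neq _ _ i3); rewrite -e32.
Qed.

(** With [s1] as origin, [s2 = {1,2}] and [s3 = {1,3}], the candidate is [{1}], and an odd point not
    adjacent to it must be [{2,3}]. These four odd points form half of a 3-cube, which [y] leaves in
    at most one coordinate. A point of [S] leaving all of this is odd and has distance at least 4
    from one of the four. *)
Lemma center_exists y : y \in S -> (forall t, t \in S -> t != y -> parity t) ->
  exists w, forall o, o \in S -> parity o -> hamming w o = 1.
Proof.
move=> yS oddS; have [s1 [s2 [s3 [[s1S s2S s3S] [p1 p2 p3 [s12 s13 s23]]]]]] := three_odd yS oddS.
exists (median s1 s2 s3) => o oS po; apply/eqP/negPn/negP => far.
have odd1 : odd (hamming (median s1 s2 s3) o) by rewrite odd_hamming parity_median // p1 po.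
have e1 := odd_hamming s1 o; have e2 := odd_hamming s2 o; have e3 := odd_hamming s3 o.
rewrite p1 p2 p3 po /= in e1 e2 e3.
have [s [i [sS e si]]] : exists s i, [/\ s \in S,
    all (fun p : cube n => p i == y i) [:: s1; s2; s3] & s i != y i].
  apply: exists_outside; apply: leq_trans bigS; rewrite ltnS.
  have := near yS oS; have := near yS s1S; have := near yS s2S; have := near yS s3S.
  have := near s1S oS; have := near s2S oS; have := near s3S oS.
  patterns y s1 s2 s3 o y N cardN pos.
  have Gv : gate y s1 s2 s3 o y (median s1 s2 s3) (fun a b c _ _ => if a == b then a else c) by move=> i; bits i.
  rewrite (cardN (fun a b c _ _ => [|| a, b | c])) /pattern_sum /=; last by move=> j; bits j.
  by clear bigS p1 p2 p3 po; count_distances; lia.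
have ps : parity s by apply: oddS => //; apply: contraNneq si => ->.
have {e} [ei1 ei2 ei3] : [/\ y i = s1 i, s2 i = s1 i & s3 i = s1 i].
  by case/and4P: e => /eqP -> /eqP -> /eqP ->.
have f1 := odd_hamming s1 s; have f2 := odd_hamming o s.
rewrite p1 po ps /= in f1 f2.
have := near s1S oS; have := near s2S oS; have := near s3S oS.
have := near s1S sS; have := near s2S sS; have := near s3S sS; have := near oS sS.
patterns s1 s2 s3 o s s1 N cardN pos.
have Gv : gate s1 s2 s3 o s s1 (median s1 s2 s3) (fun a b _ _ _ => a && b) by move=> j; bits j.
have := pos i; rewrite ei2 ei3 addbb; have -> : s1 i (+) s i by rewrite -ei1; move: si; case: (y i); case: (s i).
by case: (_ (+) _) => pi; clear bigS p1 p2 p3 po ps si ei1 ei2 ei3; count_distances; lia.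
Qed.

End Cliques.

Section FilterSet.
Variable X : finType.
Implicit Types (F : {set {set X}}) (H R S : {set X}).

Lemma setI_mono H S v :
  #|(S :\ v) :&: H| < #|S :&: H| \/ (S :\ v) :&: H = S :&: H.
Proof.
have sub : (S :\ v) :&: H \subset S :&: H by rewrite setSI ?subD1set.
by case: (eqVproper sub) => [->|/proper_card]; [right|left].
Qed.

(** With the trace on [H] frozen, a toggle point outside [H] may be chosen separately for each
    trace. *)
Lemma acyclic_filter_setI F H k : convex F ->
  (forall R, acyclic [set S in F | S :&: H == R] k) -> acyclic F k.
Proof.
move=> cF; apply: (acyclic_filter (rk := fun R : {set X} => #|R|)) => // S v _ _; exact: setI_mono.
Qed.

Lemma convex_setI F H R : convex F -> convex [set S in F | S :&: H == R].
Proof.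
move=> cF; apply: (convex_fiber (rk := fun R : {set X} => #|R|)) => // S v _ _; exact: setI_mono.
Qed.

Lemma toggle_setI H S x : x \notin H -> ((x |: S) :&: H = S :&: H) * ((S :\ x) :&: H = S :&: H).
Proof.
move=> xH; split; apply/setP => y; rewrite !inE; case: eqVneq => // ->; by rewrite (negPf xH) !andbF.
Qed.

End FilterSet.

Section LargeCliques.
Variable n : nat.
Implicit Types (x y z o s u w : cube n) (S R : {set cube n}).

Definition large_cliques : {set {set cube n}} := [set S | rips S && (4 < #|varying S|)].
Definition even_points : {set cube n} := [set x | ~~ parity x].

Lemma convex_large_cliques : convex large_cliques.
Proof.
move=> S v w; rewrite !inE => /andP[rS _] /andP[_ lt].
rewrite (ripsS _ rS) ?subD1set //=; apply: leq_trans lt _.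
by apply/subset_leq_card/varyingS; rewrite subD1set.
Qed.

Lemma between_hull S x y z u : x \in S -> y \in S -> z \in S -> between x y z u -> hull S u.
Proof.
move=> xS yS zS /forallP b i; case/or3P: (b i) => /eqP ->; by [exists x|exists y|exists z].
Qed.

(** The even points of [S] are near every odd point of the box by [between_near], so only odd points
    can obstruct. If they obstruct one odd vertex of the box, a second one works. *)
Lemma odd_near_clique S x y z : S \in large_cliques ->
  x \in S -> y \in S -> z \in S -> parity x = false -> parity y = false -> parity z = false ->
  x != y -> (z != x /\ z != y) \/ (z = y /\ forall e, e \in S -> parity e = false -> e = x \/ e = y) ->
  exists u, [/\ parity u, between x y z u & forall s, s \in S -> hamming u s <= 3].
Proof.
rewrite inE => /andP[rS lt] xS yS zS px py pz xy hz; have /ripsP near := rS.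
have xy2 : hamming x y = 2 by rewrite hamming_same_parity ?px ?near.
suff [u [pu bu hu]] : exists u, [/\ parity u, between x y z u & forall o, o \in S -> parity o -> hamming u o <= 3].
  exists u; split=> // s sS; have [/hu-> //|ps] := boolP (parity s).
  by apply: (between_near _ _ _ _ _ _ _ _ _ _ bu); rewrite ?near ?py ?pz ?px ?(negPf ps) ?pu.
case: hz => [[zx zy]|[-> onlyxy]].
  have xz2 : hamming x z = 2 by rewrite hamming_same_parity ?px ?pz ?near // eq_sym.
  have yz2 : hamming y z = 2 by rewrite hamming_same_parity ?py ?pz ?near // eq_sym.
  have pm : parity (median x y z) by rewrite parity_median // px.
  have [/exists_inP[o oS /andP[po far]]|/exists_inPn h] := boolP [exists o in S, parity o && (3 < hamming (median x y z) o)].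
    exists (sum3 (median x y z) x y); split=> [||o' o'S po'].
    - by rewrite parity_sum3 pm px py.
    - exact: between_sum3.
    by apply: (near_sum3 rS lt xS yS zS oS) => //; rewrite px.
  exists (median x y z); split=> // [|o oS po]; first exact: between_median.
  by have := h o oS; rewrite po /= -leqNgt.
have [i xyi] : exists i, x i != y i.
  have /card_gt0P[i] : 0 < #|[set i | x i != y i]| by rewrite -/(hamming x y) xy2.
  by rewrite inE; exists i.
(* One of the two common neighbors of [x] and [y]; the other is [sum3 x y h]. *)
pose h : cube n := [ffun j => x j (+) (j == i)].
have bh : between x y y h.
  by apply/forallP => j; rewrite ffunE; have [->|_] := eqVneq j i; move: xyi; bits i; bits j.
have xh : hamming x h = 1.
  rewrite /hamming -(cards1 i); apply: eq_card => j; by rewrite !inE ffunE; case: (j == i); case: (x j).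
have ph : parity h by have := odd_hamming x h; rewrite xh px.
have yh : hamming y h = 1.
  have : 0 < #|[set i | (y i == h i) && (y i != x i)]|.
    apply/card_gt0P; exists i; rewrite !inE ffunE eqxx.
    by move: xyi; bits i.
  have := odd_hamming y h; rewrite py ph /=; clearbody h.
  patterns x y h h h h N cardN pos.
  rewrite (cardN (fun a b _ _ _ => (a == b) && a)) /pattern_sum /=; last by move=> j; bits j.
  by clear lt px py pz ph; count_distances; lia.
clearbody h; have [/exists_inP[o oS /andP[po far]]|/exists_inPn hh] := boolP [exists o in S, parity o && (3 < hamming h o)].
  exists (sum3 x y h); split=> [||o' o'S po'].
  - by rewrite parity_sum3 ph px py.
  - by apply/forallP => j; move/forallP/(_ j): bh; bits j.
  rewrite leqNgt; apply/negP => far'.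
  by apply: (near_common_neighbor rS lt xS yS oS o'S xy2 xh yh) => //; rewrite px.
exists h; split=> // o oS po.
by have := hh o oS; rewrite po /= -leqNgt.
Qed.

(** Sets with at most one even point share the label [set0], because they are matched by means of a
    center instead. *)
Definition even_label S := if #|S :&: even_points| <= 1 then set0 else S :&: even_points.

Lemma even_label_mono S v :
  #|even_label (S :\ v)| < #|even_label S| \/ even_label (S :\ v) = even_label S.
Proof.
rewrite /even_label; case: (setI_mono even_points S v) => [lt|->]; last by right.
case: ifP => h1; case: ifP => h2; rewrite ?cards0; [by right| left| |by left]; lia.
Qed.

(** An odd point [u] of the box spanned by even points of [l] is toggled. Even points are kept, so
    the box stays spanned and [u] stays in the hull. *)
Lemma acyclic_two_even l k : l != set0 ->
  acyclic [set S in large_cliques | even_label S == l] k.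
Proof.
move=> l0; set F := [set S in _ | _].
have cF : convex F.
  apply: (convex_fiber (rk := fun R : {set cube n} => #|R|)); first exact: convex_large_cliques.
  by move=> S v _ _; exact: even_label_mono.
have FE S : S \in F -> [/\ S \in large_cliques, S :&: even_points = l & 1 < #|l|].
  rewrite inE => /andP[-> ]; rewrite /even_label; case: ifP => [_ /eqP e|/negbT h /eqP <-].
    by rewrite e eqxx in l0.
  by rewrite ltnNge h.
have [l1|] := leqP #|l| 1.
  apply: acyclic_card => S /FE[_ _]; by rewrite ltnNge l1.
case/card_gt1P => x [y [xl yl xy]].
(* A third element of [l] if there is one; otherwise [z = y], and the box is the square spanned by
   [x] and [y]. *)
have [z zl zP] : exists2 z, z \in l & (z != x /\ z != y) \/ (z = y /\ forall e, e \in l -> e = x \/ e = y).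
  have [/exists_inP[z zl /andP[zx zy]]|/exists_inPn h] := boolP [exists z in l, (z != x) && (z != y)].
    by exists z => //; left.
  exists y => //; right; split=> // e /h; rewrite negb_and !negbK => /orP[]/eqP; by [left|right].
(* Points of [H] are within 3 of each other. Whether [u] is near [S] thus depends only on the trace
   outside [H], and a [u] found for one [S0] serves all sets with that trace. *)
pose H : {set cube n} := [set u | parity u && between x y z u].
apply: (acyclic_filter_setI (H := ~: H)) => // R; set FR := [set S in _ | _].
have [->|[S0]] := set_0Vmem FR; first exact: acyclic_set0.
rewrite inE => /andP[S0F /eqP S0R].
have inl S e : S \in F -> e \in l = (e \in S) && ~~ parity e.
  by case/FE => _ <- _; rewrite !inE.
have lS S e : S \in F -> e \in l -> e \in S /\ parity e = false.
  by move=> SF; rewrite (inl S) // => /andP[-> /negPf].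
have [u [pu bu nearu]] : exists u, [/\ parity u, between x y z u & forall s, s \in S0 -> hamming u s <= 3].
  have [[[xS px] [yS py]] [zS pz]] := (lS _ _ S0F xl, lS _ _ S0F yl, lS _ _ S0F zl).
  apply: odd_near_clique => //; first by case/FE: S0F.
  case: zP => [|[zy h]]; [by left|right; split=> // e eS pe]; apply: h.
  by rewrite (inl S0) // eS pe.
have uH : u \notin ~: H by rewrite !inE pu bu.
have uE : u \notin even_points by rewrite inE pu.
apply: (acyclic_toggle (x := u)) => S; rewrite inE => /andP[SF /eqP SR].
have [SL Sl _] := FE _ SF; have := SL; rewrite inE => /andP[rS ltS]; have /ripsP near := rS.
have [[[xS px] [yS py]] [zS pz]] := (lS _ _ SF xl, lS _ _ SF yl, lS _ _ SF zl).
have /andP[t1 t2] : ((rips (u |: S)) && (4 < #|varying (u |: S)|)) && (rips (S :\ u) && (4 < #|varying (S :\ u)|)).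
  apply: toggle_in => // [s sS|].
    have [sH|sH] := boolP (s \in H).
      move: sH; rewrite inE => /andP[ps bs].
      by apply: hamming_between bu bs; apply: hamming_same_parity_le2; rewrite ?px ?py ?pz ?near.
    have : s \in S :&: ~: H by rewrite !inE sS /=; move: sH; rewrite inE.
    by rewrite SR -S0R inE => /andP[/nearu].
  apply: between_hull bu; rewrite !inE ?xS ?yS ?zS andbT.
  - by apply: contraTneq pu => <-; rewrite px.
  - by apply: contraTneq pu => <-; rewrite py.
  - by apply: contraTneq pu => <-; rewrite pz.
have lab S' : S' :&: even_points = S :&: even_points -> even_label S' == l.
  by move=> e; move: SF; rewrite /even_label e inE => /andP[_].
by rewrite !inE t1 t2 !(toggle_setI _ uH) SR eqxx !lab ?(toggle_setI _ uE).
Qed.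

Definition center_of S w := [forall o in S, parity o ==> (hamming w o == 1)].

Lemma center_ofP S w : reflect (forall o, o \in S -> parity o -> hamming w o = 1) (center_of S w).
Proof.
apply: (iffP forall_inP) => h o oS; first by move=> po; move: (h o oS); rewrite po => /eqP.
by apply/implyP => po; rewrite h.
Qed.

(** The two neighbors leave [w] in different coordinates. *)
Lemma neighbors_agree w s t j : hamming s t = 2 -> hamming w s = 1 -> hamming w t = 1 ->
  s j = w j \/ t j = w j.
Proof.
move=> st ws wt; have [->|] := eqVneq (s j) (w j); first by left.
have [->|] := eqVneq (t j) (w j); first by right.
patterns w s t t t t N cardN pos; move: (pos j).
by case: (w j); case: (s j); case: (t j) => //= *; exfalso; count_distances; lia.
Qed.

(** The distance from [w] to [y] is at most [1 + 3], and the step from [w] to [o] reduces it by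
    one. *)
Lemma neighbor_towards w y s o j : hamming w s = 1 -> hamming y s <= 3 -> hamming w o = 1 ->
  o j = y j -> y j != w j -> hamming o y <= 3.
Proof.
move=> ws ys wo oy yw; patterns w s y o w w N cardN pos; move: (pos j); rewrite oy.
have -> : w j (+) y j by move: yw; bits j.
by case: (_ (+) _); rewrite addbb; clear oy yw; count_distances; lia.
Qed.

Definition few_even : {set {set cube n}} := [set S in large_cliques | even_label S == set0].

Lemma few_even_rips S : S \in few_even -> rips S /\ 4 < #|varying S|.
Proof. by rewrite !inE => /andP[/andP[]]. Qed.

Lemma few_evenE S : S \in few_even -> #|S :&: even_points| <= 1.
Proof.
by rewrite inE /even_label => /andP[_]; case: leqP => // lt /eqP e; rewrite e cards0 in lt.
Qed.

Lemma few_evenP S : S \in few_even -> exists y s1 s2 s3,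
  [/\ y \in S, forall t, t \in S -> t != y -> parity t,
      [/\ s1 \in S, s2 \in S & s3 \in S], [/\ parity s1, parity s2 & parity s3] &
      [/\ hamming s1 s2 = 2, hamming s1 s3 = 2 & hamming s2 s3 = 2]].
Proof.
move=> SF; have le1 := few_evenE SF; have [rS lt] := few_even_rips SF.
have [|y yS oddS] := at_most_one_even lt.
  by apply: leq_trans le1; apply/subset_leq_card/subsetP => x; rewrite !inE.
have [s1 [s2 [s3 [[? ? ?] [? ? ? ?]]]]] := three_odd rS lt yS oddS.
by exists y, s1, s2, s3.
Qed.

Lemma few_even_center_unique S w w' : S \in few_even -> center_of S w -> center_of S w' -> w = w'.
Proof.
move=> /few_evenP[y [s1 [s2 [s3 [_ _ [? ? ?] [? ? ?] [? ? ?]]]]]] /center_ofP cw /center_ofP cw'.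
by apply: (@center_unique _ s1 s2 s3) => //; rewrite (cw, cw').
Qed.

Lemma few_even_pick S w : S \in few_even -> ([pick w | center_of S w] == Some w) = center_of S w.
Proof.
move=> SF; case: pickP => [w' cw'|/(_ w) -> //].
apply/eqP/idP => [[<-] //|cw]; congr Some; exact: few_even_center_unique SF cw' cw.
Qed.

(** A center of [S] is one of every face, and centers are unique, so the label is constant along
    faces. *)
Lemma few_even_pick_mono S v : S \in few_even -> S :\ v \in few_even ->
  [pick w | center_of (S :\ v) w] = [pick w | center_of S w].
Proof.
move=> SF SvF; apply/eqP; case: (pickP (center_of S)) => [w /center_ofP cw|no].
  rewrite few_even_pick //; apply/center_ofP => o; rewrite !inE => /andP[_ oS]; exact: cw.
have [rS lt] := few_even_rips SF.
have [y [_ [_ [_ [yS oddS _ _ _]]]]] := few_evenP SF.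
by have [w /center_ofP] := center_exists rS lt yS oddS; rewrite no.
Qed.

Lemma convex_few_even : convex few_even.
Proof.
apply: (convex_fiber (rk := fun R : {set cube n} => #|R|)); first exact: convex_large_cliques.
by move=> S v _ _; exact: even_label_mono.
Qed.

(** The sets are sorted by their center [w] and then by their trace on the even points other than
    [w]; each class is matched by one toggle. *)
Lemma acyclic_few_even k : acyclic few_even k.
Proof.
apply: (acyclic_filter (lab := fun S => [pick w | center_of S w]) (rk := fun=> 0)).
- exact: convex_few_even.
- by move=> S v SF SvF; right; apply: few_even_pick_mono.
case=> [w|]; last first.
  rewrite (_ : [set S in _ | _] = set0); first exact: acyclic_set0.
  apply/setP => S; rewrite inE [RHS]inE; apply/negP => /andP[SF].
  have [rS lt] := few_even_rips SF.
  have [y [_ [_ [_ [yS oddS _ _ _]]]]] := few_evenP SF.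
  have [w /center_ofP cw] := center_exists rS lt yS oddS.
  by case: pickP => // /(_ w); rewrite cw.
set F := [set S in _ | _].
have FE S : (S \in F) = (S \in few_even) && center_of S w.
  by rewrite inE; case: (boolP (S \in few_even)) => // SF; rewrite few_even_pick.
have cF : convex F.
  apply: (convex_fiber (rk := fun=> 0)); first exact: convex_few_even.
  by move=> S v SF SvF; right; apply: few_even_pick_mono.
apply: (acyclic_filter_setI (H := even_points :\ w)) => // R; set FR := [set S in _ | _].
have [->|[S0]] := set_0Vmem FR; first exact: acyclic_set0.
rewrite inE FE => /andP[/andP[S0F /center_ofP S0w] /eqP S0R].
have we : ~~ parity w.
  have [y [s1 [_ [_ [_ _ [s1S _ _] [p1 _ _] _]]]]] := few_evenP S0F.
  by have := odd_hamming w s1; rewrite S0w // p1; case: (parity w).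
(* At least two of the three odd neighbors of [w] survive the removal of [u], and one of these two
   agrees with [w] in coordinate [j]. *)
have hull_at S u j : S \in few_even -> center_of S w -> u j = w j -> exists2 s, s \in S :\ u & s j = u j.
  move=> /few_evenP[y [s1 [s2 [s3 [_ _ [m1 m2 m3] [p1 p2 p3] [d12 d13 d23]]]]]] /center_ofP cw uj.
  have ne s t : hamming s t = 2 -> s != t by move=> st; rewrite -hamming_eq0 st.
  have pair s t : s \in S -> t \in S -> parity s -> parity t -> hamming s t = 2 -> s != u -> t != u ->
      exists2 s, s \in S :\ u & s j = u j.
    move=> sS tS ps pt st su tu; rewrite uj.
    case: (neighbors_agree j st (cw _ sS ps) (cw _ tS pt)) => e; [exists s|exists t] => //; by rewrite !inE ?su ?tu.
  have [e1|n1] := eqVneq s1 u.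
    by apply: (pair s2 s3) => //; rewrite -e1 eq_sym; apply: ne.
  have [e2|n2] := eqVneq s2 u; last exact: (pair s1 s2).
  by apply: (pair s1 s3) => //; rewrite -e2 eq_sym; apply: ne.
have toggled u : u \notin even_points :\ w ->
   (forall S, S \in few_even -> center_of S w -> S :&: (even_points :\ w) = R ->
     [/\ hull (S :\ u) u, {in S, forall s, hamming u s <= 3},
     #|(u |: S) :&: even_points| <= 1 & center_of (u |: S) w]) -> acyclic FR k.
  move=> uH hu; apply: (acyclic_toggle (x := u)) => S; rewrite inE FE -andbA.
  case/and3P=> SF cw /eqP SR; have [hS du c1 cu] := hu S SF cw SR.
  have [rS lt] := few_even_rips SF.
  have sub : S :\ u \subset u |: S by rewrite (subset_trans (subD1set _ _)) ?subsetUr.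
  have c2 : #|(S :\ u) :&: even_points| <= 1.
    by apply: leq_trans c1; apply/subset_leq_card/setSI.
  have cu' : center_of (S :\ u) w.
    by apply/center_ofP => o oS; move/center_ofP: cu; apply; apply: (subsetP sub).
  have FRE S' : rips S' && (4 < #|varying S'|) -> #|S' :&: even_points| <= 1 -> center_of S' w ->
      S' :&: (even_points :\ w) = R -> S' \in FR.
    move=> hS' c cS' e; rewrite inE FE e eqxx andbT cS' andbT !inE hS' /=.
    by rewrite /even_label c.
  have /andP[t1 t2] := toggle_in rS lt du hS.
  by rewrite !FRE ?(toggle_setI _ uH).
(* If [R] is empty, [w] is the only possible even point and is itself toggled; otherwise [y] is the
   only even point of every set in the class. *)
have [R0|[y]] := set_0Vmem R.
  apply: (toggled w); rewrite ?inE ?eqxx // => S SF cw; rewrite R0 => SR.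
  have evenS s : s \in S -> ~~ parity s -> s = w.
    move=> sS ps; apply/eqP/negPn/negP => sw.
    by have := in_set0 s; rewrite -SR !inE sS sw ps.
  split.
  - by move=> j; apply: hull_at.
  - move=> s sS; have [ps|/(evenS _ sS) ->] := boolP (parity s); last by rewrite hammingxx.
    by move/center_ofP: cw => ->.
  - rewrite -(cards1 w); apply/subset_leq_card/subsetP => s; rewrite !inE.
    case/andP=> /predU1P[-> _|sS ps]; first by rewrite eqxx.
    by apply/eqP/evenS.
  - apply/center_ofP => o; rewrite !inE => /predU1P[-> pw|]; first by rewrite pw in we.
    by move: o; apply/center_ofP.
rewrite -S0R !inE => /and3P[yS0 yw py].
have [j yj] : exists j, y j != w j.
  apply/existsP; apply: contraNT yw => /existsPn h; apply/eqP/ffunP => j; apply/eqP/negPn/h.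
(* Flipping one coordinate of [w] towards [y]: coordinate [j] of [o] is realized by [y], the others
   by neighbors of [w], and [neighbor_towards] bounds the distance to [y]. *)
pose o : cube n := [ffun i => w i (+) (i == j)].
have wo : hamming w o = 1.
  by rewrite /hamming -(cards1 j); apply: eq_card => i; rewrite !inE ffunE; case: (i == j); case: (w i).
have oj : o j = y j by rewrite ffunE eqxx; move: yj; bits j.
have oi i : i != j -> o i = w i by rewrite ffunE => /negPf ->; rewrite addbF.
have po : parity o by have := odd_hamming w o; rewrite wo; move: we; case: (parity w); case: (parity o).
clearbody o; apply: (toggled o); first by rewrite !inE po andbF.
move=> S SF cw SR.
have yS : y \in S by have : y \in R; [rewrite -S0R !inE yw yS0 | rewrite -SR inE => /andP[]].
have evenS s : s \in S -> ~~ parity s -> s = y.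
  move=> sS ps; have /card_le1_eqP := few_evenE SF; apply; by rewrite !inE ?sS ?yS.
have oE : o \notin even_points by rewrite inE po.
split.
- move=> i; have [->|/oi] := eqVneq i j; last exact: hull_at.
  exists y => //; rewrite !inE yS andbT; by apply: contraNneq py => ->.
- move=> s sS; have [ps|/(evenS _ sS) ->] := boolP (parity s).
    apply: leq_trans (hamming_triangle o w s) _; rewrite hammingC wo.
    by move/center_ofP: cw => ->.
  have [_ [s1 [_ [_ [_ _ [s1S _ _] [p1 _ _] _]]]]] := few_evenP SF.
  move/center_ofP: cw => /(_ _ s1S p1) ws1.
  apply: neighbor_towards ws1 _ wo oj yj.
  by have [/ripsP near _] := few_even_rips SF; apply: near.
- by rewrite (toggle_setI S oE) few_evenE.
- apply/center_ofP => t; rewrite !inE => /predU1P[->|]; first by rewrite wo.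
  by move: t; apply/center_ofP.
Qed.

Lemma acyclic_large_cliques k : acyclic large_cliques k.
Proof.
apply: (acyclic_filter (lab := even_label) (rk := fun R : {set cube n} => #|R|)).
- exact: convex_large_cliques.
- by move=> S v _ _; exact: even_label_mono.
by move=> l; have [->|/acyclic_two_even] := eqVneq l set0; [exact: acyclic_few_even|apply].
Qed.

End LargeCliques.

(** * Families spanning subcubes *)

Section Subcubes.
Variable n : nat.
Implicit Types (x y z u w : cube n) (S T R U : {set cube n}) (D : {set 'I_n}) (js : seq 'I_n).

Definition proj (j : 'I_n) x : cube n := [ffun i => (i != j) && x i].
Definition upper_half (j : 'I_n) : {set cube n} := [set x : cube n | x j].
Definition proj_closed js U := forall j x, j \in js -> x \in U -> proj j x \in U.

(** For a subcube [U] with directions [js] these are the sets spanning it. The general [U] permits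
    an induction that replaces [U] by its half [x j = 1] and drops [j]. *)
Definition spanning U js : {set {set cube n}} :=
  [set S | [&& S != set0, S \subset U & all (mem (varying S)) js]].

Definition spanning_upper U j js : {set {set cube n}} :=
  [set S in spanning U js | [exists x in S, x j]].

Lemma spanningP U js S :
  reflect [/\ exists x, x \in S, S \subset U & {in js, forall j, j \in varying S}] (S \in spanning U js).
Proof.
rewrite inE; apply: (iffP and3P) => [[/set0Pn nS sU /allP vS]|[nS sU vS]]; split=> //; first exact/set0Pn.
by apply/allP.
Qed.

Lemma varying_toggle S u s i : s \in S -> s != u -> s i = u i -> i \in varying S ->
  (i \in varying (u |: S)) * (i \in varying (S :\ u)).
Proof.
move=> sS su si vi; have sub := subsetUr [set u] S.
split; first exact: (subsetP (varyingS sub)).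
have mem v : v \in S -> exists2 t, t \in S :\ u & t i = v i.
  by have [-> _|vu vS] := eqVneq v u; [exists s|exists v] => //; rewrite !inE ?su ?vu.
by have /varyingP[x [y [/mem[x' x'S <-] /mem[y' y'S <-] xi yi]]] := vi; apply/varyingP; exists x', y'.
Qed.

Lemma convex_spanning_upper U j js : convex (spanning_upper U j js).
Proof.
move=> S v w; rewrite inE => /andP[/spanningP[_ SU _] _].
rewrite inE => /andP[/spanningP[[x xS] _ vS] /exists_inP[y yS yj]].
have sub := subD1set (S :\ v) w.
rewrite inE; apply/andP; split; last by apply/exists_inP; exists y => //; apply: (subsetP sub).
apply/spanningP; split; first by exists x; apply: (subsetP sub).
  by apply: subset_trans SU; apply: subD1set.
by move=> i /vS; apply: (subsetP (varyingS sub)).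
Qed.

(** After the trace on the upper half is fixed, the projection of one of its points [x] is toggled.
    It differs from [x] only in direction [j], which is not in [js], so [x] replaces it in all
    required directions. *)
Lemma acyclic_spanning_upper U j js k : j \notin js -> proj_closed (j :: js) U ->
  acyclic (spanning_upper U j js) k.
Proof.
move=> jjs cU; apply: (acyclic_filter_setI (H := upper_half j)); first exact: convex_spanning_upper.
move=> R; have [R0|[x xR]] := set_0Vmem R.
  rewrite (_ : [set _ in _ | _] = set0); first exact: acyclic_set0.
  apply/setP => S; rewrite inE [RHS]inE; apply/negP => /andP[]; rewrite inE => /andP[_ /exists_inP[x xS xj]].
  by move=> /eqP e; have := in_set0 x; rewrite -R0 -e !inE xS xj.
apply: (acyclic_toggle (x := proj j x)) => S; rewrite inE => /andP[SF /eqP SR].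
have pH : proj j x \notin upper_half j by rewrite !inE ffunE eqxx.
have /setIP[xS] : x \in S :&: upper_half j by rewrite SR.
rewrite inE => xj; have xp : x != proj j x by apply: contraNneq pH => <-; rewrite inE.
have /spanningP[_ SU vS] : S \in spanning U js by move: SF; rewrite inE => /andP[].
have keep S' : x \in S' -> S' \subset U -> {in js, forall j, j \in varying S'} -> S' :&: upper_half j = R ->
    S' \in [set S in spanning_upper U j js | S :&: upper_half j == R].
  move=> xS' S'U vS' e; rewrite inE e eqxx andbT inE; apply/andP; split; last by apply/exists_inP; exists x.
  by apply/spanningP; split=> //; exists x.
have agree i : i \in js -> x i = proj j x i.
  by rewrite ffunE; case: eqVneq => // ->; rewrite (negPf jjs).
have vt i (ijs : i \in js) := varying_toggle xS xp (agree i ijs) (vS i ijs).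
apply/andP; split; apply: keep; rewrite ?(toggle_setI _ pH) //.
- by rewrite !inE xS orbT.
- by rewrite subUset SU sub1set andbT; apply: cU; rewrite ?mem_head ?(subsetP SU).
- by move=> i /vt[].
- by rewrite !inE xS xp.
- by apply: subset_trans SU; apply: subD1set.
- by move=> i /vt[].
Qed.

Lemma proj_closed_upper U j js : j \notin js -> proj_closed (j :: js) U ->
  proj_closed js (U :&: upper_half j).
Proof.
move=> jjs cU i x ijs; rewrite !inE => /andP[xU xj]; rewrite cU ?inE ?ijs ?orbT //= ffunE xj andbT.
by apply: contraNneq jjs => ->.
Qed.

(** A set meeting the upper half either lies inside it or varies in direction [j]. *)
Lemma spanning_upperE U j js :
  [/\ spanning_upper U j js = spanning (U :&: upper_half j) js :|: spanning U (j :: js),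
      [disjoint spanning (U :&: upper_half j) js & spanning U (j :: js)]
    & lower (spanning (U :&: upper_half j) js) (spanning U (j :: js))].
Proof.
have nvar S : S \subset U :&: upper_half j -> j \notin varying S.
  move=> /subsetP sub; apply/negP => /varyingP[x [y [_ /sub yH _ /negPf yj]]].
  by move: yH; rewrite !inE yj andbF.
split.
- apply/setP => S; rewrite [in LHS]inE [in RHS]inE; apply/andP/orP.
    case=> /spanningP[nS SU vS] /exists_inP[x xS xj].
    have [sub|] := boolP (S \subset upper_half j).
      by left; apply/spanningP; rewrite subsetI SU.
    case/subsetPn => y yS; rewrite inE => yj; right; apply/spanningP; split=> // i.
    by rewrite inE => /predU1P[->|/vS //]; apply/varyingP; exists x, y.
  case=> /spanningP[[x xS] SU vS].
    split; last by apply/exists_inP; exists x => //; move: (subsetP SU _ xS); rewrite !inE => /andP[].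
    by apply/spanningP; split=> //; [exists x|move: SU; rewrite subsetI => /andP[]].
  have /varyingP[y [_ [yS _ yj _]]] := vS j (mem_head _ _).
  split; last by apply/exists_inP; exists y.
  by apply/spanningP; split=> //; [exists x|move=> i ijs; rewrite vS ?inE ?ijs ?orbT].
- rewrite disjoint_subset; apply/subsetP => S /spanningP[_ SU _]; rewrite !inE.
  by rewrite /= (negPf (nvar _ SU)) !andbF.
- move=> S v /spanningP[_ SU _]; apply/negP => /spanningP[_ _ /(_ _ (mem_head _ _))].
  by apply/negP/nvar/(subset_trans (subD1set _ _)).
Qed.

(** Since [spanning_upper] is acyclic, each direction shifts the homology up by one degree; without
    directions it is the unreduced homology of a simplex. *)
Lemma acyclic_spanning js U k : uniq js -> proj_closed js U -> k != (size js).+1 ->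
  acyclic (spanning U js) k.
Proof.
elim: js U k => [|j js IH] U k /=.
  move=> _ _ k1; have [->|[x xU]] := set_0Vmem U.
    apply: acyclic_card => S /spanningP[[x xS] /subsetP/(_ _ xS)]; by rewrite inE.
  (* The singleton of [x] is left over, its partner [set0] being excluded; all other sets are paired
     by toggling [x]. *)
  apply: (@acyclic_ext _ _ [set [set x]] (spanning U [::] :\ [set x])).
  - move=> S v w /spanningP[_ SU _] /spanningP[[y yS] _ _]; apply/spanningP; split=> //.
      by exists y; apply: (subsetP (subD1set _ _)) yS.
    by apply: subset_trans SU; apply: subD1set.
  - rewrite setD1K //; apply/spanningP; split=> //; first by exists x; rewrite inE.
    by rewrite sub1set.
  - move=> S v; rewrite !inE => /eqP ->; apply/negP => /andP[].
    have [->|vx] := eqVneq v x; first by rewrite (_ : _ :\ _ = set0) ?eqxx // setDv.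
    by rewrite (_ : _ :\ _ = [set x]) ?eqxx //; apply/setDidPl; rewrite disjoints1 inE eq_sym.
  - by apply: acyclic_card => S /set1P ->; rewrite cards1 eq_sym.
  apply: (acyclic_toggle (x := x)) => S; rewrite !inE => /and3P[Sx S0 /andP[SU _]].
  have [y yS yx] : exists2 y, y \in S & y != x.
    have /set0Pn[y0 y0S] := S0; have [e|ne] := eqVneq y0 x; last by exists y0.
    have /subsetPn[y yS] : ~~ (S \subset [set x]).
      by rewrite subset1 negb_or Sx S0.
    by rewrite inE; exists y.
  apply/andP; split; apply/and4P; split=> //.
  - apply/eqP => e; have : y \in x |: S by rewrite !inE yS orbT.
    by rewrite e inE (negPf yx).
  - by apply/set0Pn; exists x; rewrite setU11.
  - by rewrite subUset sub1set xU.
  - by apply/eqP => e; have := set11 x; rewrite -e !inE eqxx.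
  - by apply/set0Pn; exists y; rewrite !inE yx.
  - by apply: subset_trans SU; apply: subD1set.
case/andP=> jjs ujs cU; case: k => [_|k].
  by apply: acyclic_card => S /spanningP[[x xS] _ _]; rewrite cards_eq0; apply/set0Pn; exists x.
rewrite eqSS => nk; have [FE dis low] := spanning_upperE U j js.
apply: (acyclic_quot (@convex_spanning_upper U j js) FE dis low).
  exact: acyclic_spanning_upper.
by apply: IH => //; apply: proj_closed_upper.
Qed.

End Subcubes.

(** * Filtration by the spanned subcube *)

Section Vanishing.
Variable n : nat.
Implicit Types (x y z u w b : cube n) (S T R U : {set cube n}) (D : {set 'I_n}).
Implicit Types (F : {set {set cube n}}).

Definition subcube D b : {set cube n} := [set x : cube n | [forall i, (i \notin D) ==> (x i == b i)]].

Lemma subcubeP D b x : reflect (forall i, i \notin D -> x i = b i) (x \in subcube D b).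
Proof.
by rewrite inE; apply: (iffP forallP) => h i; [move=> iD; move: (h i); rewrite iD => /eqP|apply/implyP => /h ->].
Qed.

Lemma varying_subcube S D b : S \subset subcube D b -> varying S \subset D.
Proof.
move=> /subsetP sub; apply/subsetP => i /varyingP[x [y [/sub/subcubeP xS /sub/subcubeP yS xi yi]]].
by apply/negPn/negP => iD; rewrite yS // -xS // xi in yi.
Qed.

Lemma card_subcube_half D b j : j \in D -> #|subcube D b :&: upper_half j| = 2 ^ #|D|.-1.
Proof.
move=> jD; pose f (A : {set 'I_n}) : cube n := [ffun i => if i \in D then (i == j) || (i \in A) else b i].
rewrite (_ : #|D|.-1 = #|D :\ j|); last by rewrite (cardsD1 j D) jD.
rewrite -card_powerset -(card_in_imset (f := f)); last first.
  move=> A B; rewrite !inE => /subsetP AD /subsetP BD e; apply/setP => i.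
  have [iD|iD] := boolP (i \in D :\ j).
    by move: (iD); rewrite !inE => /andP[/negPf ij iD']; move/ffunP/(_ i): e; rewrite !ffunE iD' ij.
  by rewrite (contraNF (AD i) iD) (contraNF (BD i) iD).
apply: eq_card => x; apply/idP/imsetP => [|[A]].
  case/setIP=> /subcubeP xb; rewrite inE => xj.
  exists [set i in D :\ j | x i]; first by rewrite inE; apply/subsetP => i; rewrite !inE => /andP[].
  apply/ffunP => i; rewrite ffunE !inE; case: ifP => [iD|/negbT /xb //].
  by rewrite iD; case: eqVneq => [->|_].
rewrite inE => /subsetP AD ->; rewrite in_setI [X in _ && X]inE ffunE jD eqxx andbT.
by apply/subcubeP => i /negPf iD; rewrite ffunE iD.
Qed.

Lemma card_subcube D b : #|subcube D b| <= 2 ^ #|D|.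
Proof.
rewrite -card_powerset; pose f x := [set i in D | x i].
rewrite -(card_in_imset (f := f) (D := mem (subcube D b))).
  by apply/subset_leq_card/subsetP => A /imsetP[x _ ->]; rewrite inE; apply/subsetP => i; rewrite inE => /andP[].
move=> x y /subcubeP xb /subcubeP yb e; apply/ffunP => i; have [iD|iD] := boolP (i \in D); last by rewrite xb ?yb.
by move/setP/(_ i): e; rewrite !inE iD.
Qed.

(** For nonempty [S], the least vertex of the subcube that it spans. *)
Definition corner S : cube n := [ffun i => [forall x in S, x i]].

Lemma cornerE S x i : x \in S -> i \notin varying S -> corner S i = x i.
Proof.
move=> xS iv; rewrite ffunE; have agree y : y \in S -> y i = x i.
  move=> yS; case e : (y i); case e' : (x i) => //; case/negP: iv; apply/varyingP.
    by exists y, x; rewrite e e'.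
  by exists x, y; rewrite e e'.
by apply/forall_inP/idP => [/(_ x xS) //|xi y /agree ->].
Qed.

Lemma corner_varying S i : i \in varying S -> corner S i = false.
Proof. by case/varyingP=> x [y [xS yS xi yi]]; rewrite ffunE; apply/forall_inP => /(_ y yS); apply/negP. Qed.

Lemma sub_subcube S : S \subset subcube (varying S) (corner S).
Proof. by apply/subsetP => x xS; apply/subcubeP => i iv; rewrite (cornerE xS). Qed.

(* Within a subcube, the normalization [b i = false] on the free coordinates makes
   the pair of labels determine the subcube spanned. *)
Lemma spanned_subcubeE S D b x : x \in S -> {in D, forall i, b i = false} ->
  (varying S == D) && (corner S == b) = (S \subset subcube D b) && (D \subset varying S).
Proof.
move=> xS bD; apply/andP/andP => [[/eqP <- /eqP <-]|[sub DS]]; first by rewrite sub_subcube.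
have e : varying S = D by apply/eqP; rewrite eqEsubset (varying_subcube sub).
split; apply/eqP => //; apply/ffunP => i; have [iD|iD] := boolP (i \in D).
  by rewrite corner_varying ?e // bD.
by rewrite (cornerE xS) ?e //; move: (subsetP sub _ xS) => /subcubeP ->.
Qed.

(** Deleting a point either loses a varying coordinate or keeps the spanned subcube. The exclusion
    of [set0] rules out passing from a singleton to [set0], which would change the corner but not
    the dimension. *)
Lemma acyclic_filter_subcube F k : convex F -> set0 \notin F ->
  (forall D b, {in D, forall i, b i = false} ->
    acyclic [set S in F | (S \subset subcube D b) && (D \subset varying S)] k) -> acyclic F k.
Proof.
move=> cF F0 hF.
have nonempty S : S \in F -> exists x, x \in S.
  by move=> SF; apply/set0Pn; apply: contraNneq F0 => <-.
apply: (acyclic_filter (lab := fun S => (varying S, corner S)) (rk := fun p => #|p.1|)) => //.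
  move=> S v SF SvF; have sub := varyingS (subD1set S v).
  case: (eqVproper sub) => [e|/proper_card]; [right|by left].
  rewrite e; congr pair; apply/ffunP => i; have [x xS] := nonempty _ SvF.
  have [iv|iv] := boolP (i \in varying S); first by rewrite !corner_varying ?e.
  by rewrite (cornerE xS) ?e // (@cornerE _ x) //; apply: (subsetP (subD1set _ _)) xS.
move=> [D b]; have [/forall_inP bD|/forall_inPn[i iD bi]] := boolP [forall i in D, ~~ b i].
  rewrite (_ : [set _ in _ | _] = [set S in F | (S \subset subcube D b) && (D \subset varying S)]).
    by apply: hF => i /bD /negPf.
  apply/setP => S; rewrite !inE; case: (boolP (S \in F)) => // /nonempty[x xS] /=.
  by rewrite -(spanned_subcubeE xS) // => i /bD /negPf.
rewrite (_ : [set _ in _ | _] = set0); first exact: acyclic_set0.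
apply/setP => S; rewrite !inE; apply/negP => /andP[_ /eqP[e1 e2]].
by move: bi; rewrite -e2 negbK corner_varying // e1.
Qed.

Lemma acyclic_dimension F (P : pred nat) k : convex F ->
  (forall S, S \in F = (S != set0) && P #|varying S|) ->
  (forall m, P m -> k != m.+1) -> acyclic F k.
Proof.
move=> cF FE hP; apply: acyclic_filter_subcube => //; first by rewrite FE eqxx.
move=> D b bD; have [PD|PD] := boolP (P #|D|); last first.
  rewrite (_ : [set _ in _ | _] = set0); first exact: acyclic_set0.
  apply/setP => S; rewrite !inE FE; apply/negP => /andP[/andP[/set0Pn[x xS] PS] e].
  by move: e PD; rewrite -(spanned_subcubeE xS) // => /andP[/eqP <-]; rewrite PS.
rewrite (_ : [set _ in _ | _] = spanning (subcube D b) (enum D)).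
  apply: acyclic_spanning; rewrite ?enum_uniq -?cardE ?hP // => j x.
  rewrite mem_enum => jD /subcubeP xb; apply/subcubeP => i iD.
  by rewrite ffunE xb //; case: eqVneq iD => // ->; rewrite jD.
apply/setP => S; rewrite !inE FE; case: (boolP (S == set0)) => //= /set0Pn[x xS].
rewrite (_ : all _ _ = (D \subset varying S)); last first.
  apply/allP/subsetP => h i; first by move=> iD; apply: h; rewrite mem_enum.
  by rewrite mem_enum; apply: h.
case: (boolP (_ \subset _)) => sub; rewrite /= ?andbF //; case: (boolP (D \subset _)) => DS; rewrite ?andbF ?andbT //.
suff /eqP -> : varying S == D by [].
by rewrite eqEsubset (varying_subcube sub).
Qed.

Definition low_sets : {set {set cube n}} := [set S | #|varying S| <= 4].
Definition high_sets : {set {set cube n}} := [set S | 4 < #|varying S|].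
Definition low_cliques : {set {set cube n}} := [set S in low_sets | rips S].
Definition low_noncliques : {set {set cube n}} := [set S in low_sets | ~~ rips S].

Lemma varying0 : varying (set0 : {set cube n}) = set0.
Proof. by apply/setP => i; rewrite [RHS]inE; apply/varyingP => -[x [y []]]; rewrite inE. Qed.

(** All sets together form a full simplex, which is acyclic, and the quotient by the low sets has
    homology only from dimension 5 on, that is, at 6 or more vertices. *)
Lemma acyclic_low_sets_small k : k <= 4 -> acyclic low_sets k.
Proof.
move=> k4; apply: (@acyclic_sub _ setT low_sets high_sets).
- by move=> S v w; rewrite !inE.
- by apply/setP => S; rewrite !inE leqNgt orNb.
- by rewrite disjoint_subset; apply/subsetP => S; rewrite !inE -leqNgt.
- move=> S v; rewrite !inE -leqNgt; apply: leq_trans.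
  by apply/subset_leq_card/varyingS/subD1set.
- apply: (@acyclic_dimension _ (fun m => 4 < m)) => [S v w|S|m]; rewrite ?inE.
  + move=> _ /leq_trans; apply; apply/subset_leq_card/varyingS/subD1set.
  + by case: eqVneq => //= ->; rewrite varying0 cards0.
  + by case: ltngtP => //; lia.
- by apply: (acyclic_toggle (x := [ffun=> false])) => S; rewrite !inE.
Qed.

(** Apart from [set0], the subcubes involved have dimension at most 4 and contribute at 5 vertices
    at most. *)
Lemma acyclic_low_sets_large k : 5 < k -> acyclic low_sets k.
Proof.
move=> k5; apply: (@acyclic_ext _ _ [set set0] (low_sets :\ set0)).
- move=> S v w; rewrite !inE => lt _; apply: leq_trans lt.
  by apply/subset_leq_card/varyingS/subD1set.
- by rewrite setD1K // inE varying0 cards0.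
- by move=> S v; rewrite !inE => /eqP ->; rewrite set0D eqxx.
- by apply: acyclic_card => S /set1P ->; rewrite cards0; lia.
apply: (@acyclic_dimension _ (fun m => m <= 4)) => [S v w|S|m].
- rewrite !inE => /andP[_ lt] /andP[nz _]; apply/andP; split.
    by apply: contraNneq nz => ->; rewrite set0D.
  by apply: leq_trans lt; apply/subset_leq_card/varyingS/subD1set.
- by rewrite !inE.
- by lia.
Qed.

Lemma acyclic_low_sets k : k != 5 -> acyclic low_sets k.
Proof. by case: ltngtP => // [/acyclic_low_sets_small|/acyclic_low_sets_large]. Qed.

End Vanishing.

(** * Sets containing antipodes *)

Section Antipodes.
Variable n : nat.
Variables (D : {set 'I_n}) (b : cube n).
Implicit Types (x y z u w : cube n) (S T R U : {set cube n}).

Definition antipode x : cube n := [ffun i => x i (+) (i \in D)].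

Lemma antipodeK : involutive antipode.
Proof. by move=> x; apply/ffunP => i; rewrite !ffunE addbK. Qed.

Lemma antipode_subcube x : x \in subcube D b -> antipode x \in subcube D b.
Proof. by move=> /subcubeP xb; apply/subcubeP => i iD; rewrite ffunE (negPf iD) addbF xb. Qed.

Lemma antipode_half j x : j \in D -> (antipode x \in upper_half j) = (x \notin upper_half j).
Proof. by move=> jD; rewrite !inE ffunE jD addbT. Qed.

Lemma hamming_antipode x : hamming x (antipode x) = #|D|.
Proof. by apply: eq_card => i; rewrite !inE ffunE; case: (x i); case: (i \in D). Qed.

Lemma hamming_subcube x y : x \in subcube D b -> y \in subcube D b ->
  (hamming x y <= #|D|) /\ (#|D| <= hamming x y -> y = antipode x).
Proof.
move=> /subcubeP xb /subcubeP yb.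
have sub : [set i | x i != y i] \subset D.
  by apply/subsetP => i; rewrite inE; apply: contraNT => iD; rewrite xb ?yb.
split; first exact: subset_leq_card.
move=> le; have /eqP e : [set i | x i != y i] == D by rewrite eqEcard sub.
by apply/ffunP => i; rewrite ffunE -e inE; case: (x i); case: (y i).
Qed.

Definition has_antipodes S := [exists x in S, antipode x \in S].

Lemma subcube_rips S : #|D| = 4 -> S \subset subcube D b -> rips S = ~~ has_antipodes S.
Proof.
move=> D4 /subsetP sub; apply/idP/idP => [/ripsP near|/exists_inPn no].
  apply/exists_inP => -[x xS axS]; have := near x _ xS axS; by rewrite hamming_antipode D4.
apply/ripsP => x y xS yS; rewrite leqNgt; apply/negP => far.
have [_ yx] := hamming_subcube (sub _ xS) (sub _ yS).
by have := no x xS; rewrite -yx ?yS // D4.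
Qed.

Lemma antipodes_varying S : has_antipodes S -> D \subset varying S.
Proof.
case/exists_inP => x xS axS; apply/subsetP => i iD; apply/varyingP.
by case e : (x i); [exists x, (antipode x)|exists (antipode x), x]; rewrite ffunE iD e.
Qed.

Definition antipodal_sets : {set {set cube n}} := [set S : {set cube n} | (S \subset subcube D b) && has_antipodes S].

Lemma convex_antipodal_sets : convex antipodal_sets.
Proof.
move=> S v w; rewrite !inE => /andP[SU _] /andP[_ /exists_inP[x xS axS]].
have /subsetP sub := subD1set (S :\ v) w.
rewrite (subset_trans (subD1set _ _) SU); apply/exists_inP; exists x; exact: sub.
Qed.

Variable j : 'I_n.
Hypothesis jD : j \in D.
Let top := subcube D b :&: upper_half j.

(** The sets are sorted by their trace [R] on the upper half [top]. A single set with [#|top| + 1]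
    vertices remains unmatched. *)
Lemma acyclic_antipodal_sets k : k != #|top|.+1 -> acyclic antipodal_sets k.
Proof.
move=> kt; apply: (acyclic_filter_setI (H := upper_half j)); first exact: convex_antipodal_sets.
move=> R; set FR := [set S in _ | _].
have FRP S : reflect [/\ S \subset subcube D b, S :&: upper_half j = R &
    exists2 x, x \in R & antipode x \in S] (S \in FR).
  rewrite 2!inE; apply: (iffP andP) => [[/andP[SU /exists_inP[x xS axS]] /eqP SR]|[SU SR [x xR axS]]].
    split=> //; have [xj|xj] := boolP (x \in upper_half j).
      by exists x => //; rewrite -SR inE xS.
    by exists (antipode x); rewrite ?antipodeK // -SR inE axS antipode_half.
  rewrite SR eqxx SU; split=> //; apply/exists_inP; exists x => //.
  by move: xR; rewrite -SR => /setIP[].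
have topE x : (x \in top) = (x \in subcube D b) && (x \in upper_half j) by rewrite in_setI.
have Rtop S : S \in FR -> R \subset top.
  by case/FRP => SU <- _; apply: setSI.
have low x : x \in top -> antipode x \notin upper_half j.
  by rewrite topE antipode_half // negbK => /andP[].
(* If [R] misses [x], toggling the antipode of [x] neither creates nor destroys an antipodal
   pair. *)
have [topR|/subsetPn[x xt xR]] := boolP (top \subset R); last first.
  have uH := low x xt; have ux : antipode x \in subcube D b.
    by apply: antipode_subcube; move: xt; rewrite topE => /andP[].
  apply: (acyclic_toggle (x := antipode x)) => S /FRP[SU SR [y yR ayS]].
  have ne : antipode y != antipode x.
    by rewrite (inj_eq (can_inj antipodeK)); apply: contraNneq xR => <-.
  apply/andP; split; apply/FRP; rewrite ?(toggle_setI _ uH); split=> //.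
  - by rewrite subUset sub1set ux.
  - by exists y => //; rewrite !inE ayS orbT.
  - by apply: subset_trans SU; apply: subD1set.
  - by exists y => //; rewrite !inE ayS ne.
have [->|[S0 S0F]] := set_0Vmem FR; first exact: acyclic_set0.
have {topR} Re : R = top by apply/eqP; rewrite eqEsubset topR (Rtop S0).
have /FRP[S0U S0R [y yR ayS0]] := S0F.
pose x0 := antipode y; have x0H : x0 \notin upper_half j by apply: low; rewrite -Re.
have x0U : x0 \in subcube D b by apply: (subsetP S0U).
have FRT S t : S \subset subcube D b -> S :&: upper_half j = R -> t \in S -> t \notin upper_half j -> S \in FR.
  move=> SU SR tS tj; apply/FRP; split=> //; exists (antipode t); rewrite ?antipodeK //.
  by rewrite Re topE antipode_half // tj antipode_subcube ?(subsetP SU).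
have FRt S : S \in FR -> exists2 t, t \in S & t \notin upper_half j.
  by case/FRP=> SU SR [x xR axS]; exists (antipode x) => //; apply: low; rewrite -Re.
have RS S x : S \in FR -> x \in S -> x \in upper_half j -> x \in R.
  by case/FRP=> _ <- _ xS xj; rewrite inE xS.
have SR S : S \in FR -> R \subset S by case/FRP => _ <- _; apply: subsetIl.
have RH : R :&: upper_half j = R by rewrite -{2}S0R -S0R -setIA setIid.
have x0R : x0 \notin R by apply: contra x0H; rewrite -S0R => /setIP[].
have cF : convex FR by apply/convex_setI/convex_antipodal_sets.
have S1F : x0 |: R \in FR.
  apply: (FRT _ x0) => //; rewrite ?setU11 ?(toggle_setI R x0H) //.
  by rewrite subUset sub1set x0U (subset_trans (SR _ S0F) S0U).
(* When [R] is the whole [top], the lower part of [S] is an arbitrary nonempty set; toggling [x0]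
   pairs all of these except the one with lower part [x0] alone. *)
apply: (@acyclic_ext _ _ [set x0 |: R] (FR :\ (x0 |: R))) => //; first by rewrite setD1K.
- move=> S v /set1P ->; rewrite in_setD1; apply/negP => /andP[ne SF].
  have [t] := FRt _ SF; rewrite !inE => /andP[tv /predU1P[tx|tR]] tj; last first.
    by have := subsetP (Rtop _ S0F) _ tR; rewrite topE [t \in upper_half j]inE (negPf tj) andbF.
  case/eqP: ne; apply/setDidPl; rewrite disjoint_sym disjoints1 in_setU1 negb_or -tx eq_sym tv.
  apply: contraNN (_ : v \notin (x0 |: R) :\ v); last by rewrite setD11.
  by apply: (subsetP (SR _ SF)).
- apply: acyclic_card => S /set1P ->; by rewrite cardsU1 x0R add1n Re eq_sym.
apply: (acyclic_toggle (x := x0)) => S /setD1P[ne SF].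
have /FRP[SU SHR _] := SF.
have [t tS /andP[tx tj]] : exists2 t, t \in S & (t != x0) && (t \notin upper_half j).
  apply/exists_inP; apply: contraNT ne => /exists_inPn h; rewrite eqEsubset; apply/andP; split.
    apply/subsetP => x xS; have := h x xS; rewrite negb_and !negbK in_setU1 => /orP[->//|xj].
    by rewrite (RS S) ?orbT.
  rewrite subUset (SR _ SF) andbT sub1set; have [t tS tj] := FRt _ SF.
  by have := h t tS; rewrite tj andbT negbK => /eqP <-.
have tR : t \notin R by apply: contra tj; rewrite -S0R => /setIP[].
have out S' : t \in S' -> S' != x0 |: R.
  by apply: contraTneq => ->; rewrite in_setU1 negb_or tx.
have tS1 : t \in x0 |: S by rewrite in_setU1 tS orbT.
have tS2 : t \in S :\ x0 by rewrite in_setD1 tx.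
rewrite !in_setD1 !out //=; apply/andP; split; apply: (FRT _ t); rewrite ?(toggle_setI _ x0H) //.
- by rewrite subUset sub1set x0U.
- by apply: subset_trans SU; apply: subD1set.
Qed.

End Antipodes.

(** * Vanishing outside degrees 4 and 7 *)

Section Vanishing2.
Variable n : nat.
Implicit Types (S : {set cube n}).

Lemma convex_low_noncliques : convex (low_noncliques n).
Proof.
move=> S v w; rewrite !inE => /andP[lt _] /andP[_ nr]; apply/andP; split.
  by apply: leq_trans lt; apply/subset_leq_card/varyingS/subD1set.
by apply: contra nr; apply: ripsS; apply: subD1set.
Qed.

(** In dimension below 4 all distances are at most 3, and in a 4-subcube the non-cliques are the
    sets with antipodes; the exceptional count is [2 ^ 3 + 1 = 9]. *)
Lemma acyclic_low_noncliques k : k != 9 -> acyclic (low_noncliques n) k.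
Proof.
move=> k9; apply: acyclic_filter_subcube; first exact: convex_low_noncliques.
  by rewrite !inE negb_and orbC negbK; apply/orP; left; apply/ripsP => x y; rewrite inE.
move=> D b bD; have [D4|D4] := eqVneq #|D| 4; last first.
  rewrite (_ : [set _ in _ | _] = set0); first exact: acyclic_set0.
  apply/setP => S; rewrite !inE; apply/negP => /andP[/andP[le /negP nr] /andP[SU DS]].
  have lt : #|D| < 4 by rewrite ltn_neqAle D4 (leq_trans (subset_leq_card DS)).
  case: nr; apply/ripsP => x y xS yS; rewrite -ltnS; apply: leq_ltn_trans lt.
  by case: (hamming_subcube (subsetP SU _ xS) (subsetP SU _ yS)).
have /card_gt0P[j jD] : 0 < #|D| by rewrite D4.
rewrite (_ : [set _ in _ | _] = antipodal_sets D b).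
  by apply: (acyclic_antipodal_sets jD); rewrite card_subcube_half // D4.
apply/setP => S; rewrite !inE; apply/andP/andP => [[/andP[_ nr] /andP[SU DS]]|[SU an]].
  by split=> //; move: nr; rewrite (subcube_rips D4 SU) negbK.
rewrite SU antipodes_varying // (subcube_rips D4 SU) negbK an andbT -D4.
by split=> //; apply/subset_leq_card/(varying_subcube SU).
Qed.

(** The low sets contribute at 5 vertices, and the non-cliques at 9, which the connecting map lowers
    to 8. *)
Lemma acyclic_low_cliques k : k != 5 -> k != 8 -> acyclic (low_cliques n) k.
Proof.
move=> k5 k8; apply: (@acyclic_sub _ (low_sets n) _ (low_noncliques n)).
- move=> S v w; rewrite !inE => lt _; apply: leq_trans lt.
  by apply/subset_leq_card/varyingS/subD1set.
- by apply/setP => S; rewrite !inE -andb_orr orbN andbT.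
- by rewrite disjoint_subset; apply/subsetP => S; rewrite !inE => /andP[-> ->].
- move=> S v; rewrite !inE => /andP[_ rS]; rewrite negb_and negbK; apply/orP; right.
  by apply: ripsS rS; apply: subD1set.
- by apply: acyclic_low_noncliques; rewrite eqSS.
- exact: acyclic_low_sets.
Qed.

Definition cliques : {set {set cube n}} := [set S : {set cube n} | rips S].

Lemma cliquesE : cliques = low_cliques n :|: large_cliques n.
Proof. by apply/setP => S; rewrite !inE leqNgt; case: (rips S); rewrite ?andbF //= andbT orNb. Qed.

Lemma convex_cliques : convex cliques.
Proof. by move=> S v w; rewrite !inE => rS _; apply: ripsS rS; apply: subD1set. Qed.

Lemma lower_cliques : lower (low_cliques n) (large_cliques n).
Proof.
move=> S v; rewrite !inE => /andP[lt _]; rewrite negb_and -leqNgt; apply/orP; right.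
by apply: leq_trans lt; apply/subset_leq_card/varyingS/subD1set.
Qed.

Lemma disjoint_cliques : [disjoint low_cliques n & large_cliques n].
Proof. by rewrite disjoint_subset; apply/subsetP => S; rewrite !inE => /andP[le _]; rewrite ltnNge le andbF. Qed.

Lemma acyclic_cliques k : k != 5 -> k != 8 -> acyclic cliques k.
Proof.
move=> k5 k8; apply: (acyclic_ext convex_cliques cliquesE lower_cliques).
  exact: acyclic_low_cliques.
exact: acyclic_large_cliques.
Qed.

Lemma is_chain_on k c : is_chain (@hamming n) 3 k c <-> on cliques k c.
Proof. by split=> h s /h; rewrite inE. Qed.

Lemma reduced_homology_vanishes i : acyclic cliques i.+1 -> ~ reduced_homology_nonzero (@hamming n) 3 i.
Proof.
move=> ac [z [/is_chain_on zc z0 []]].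
have [|b bc be] := ac z zc; first by move=> t _; rewrite z0 chain0E.
exists b; split; first exact/is_chain_on.
apply/ffunP => t; have [/be //|tc] := boolP (t \in cliques).
rewrite (on_out zc) //; apply/eqP/negPn/negP => /boundary_supp[v vt /bc /andP[]].
by rewrite inE => /(ripsS (subsetUr _ _)); move: tc; rewrite inE => /negPf ->.
Qed.

(* The large cliques being acyclic, a filling of [z] can be pushed into the low ones. *)
Lemma reduced_homology_nonzero_low i z :
  on (low_cliques n) i.+1 z -> boundary z = 0%R ->
  (forall b, on (low_cliques n) i.+2 b -> boundary b <> z) ->
  reduced_homology_nonzero (@hamming n) 3 i.
Proof.
move=> zl z0 nb; have sub : {subset low_cliques n <= cliques} by move=> S Sl; rewrite cliquesE in_setU Sl.
exists z; split=> //; first by apply/is_chain_on/(on_sub sub).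
move=> [b [/is_chain_on bc bz]].
have [||c cl ce] := @acyclic_large_cliques n i.+2 (restrict (large_cliques n) b).
- exact: on_restrict bc.
- move=> t tl; rewrite (boundary_restrict_upper cliquesE lower_cliques bc tl) bz.
  by rewrite (on_out zl) // (disjointFl disjoint_cliques).
apply: (nb (b - boundary c)%R); last by rewrite boundaryB boundary_boundary subr0.
move=> S; rewrite chainDE chainNE => bS.
have [SF Sk] : S \in cliques /\ #|S| == i.+2.
  have [b0|/bc /andP[] //] := eqVneq (b S) 0%R; move: bS; rewrite b0 add0r oppr_eq0.
  move=> /boundary_supp[v vS /cl /andP[]]; rewrite !inE cardsU1 vS add1n eqSS => /andP[rS _] Sk; split=> //.
  exact: ripsS (subsetUr _ _) rS.
rewrite Sk andbT; move: SF; rewrite cliquesE inE => /orP[//|Sl].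
by rewrite ce // restrictE Sl subrr eqxx in bS.
Qed.

End Vanishing2.

(** * Nonvanishing homology *)

Section CrossPolytope.
Local Open Scope ring_scope.
Variables (X : finType) (a : X -> X).
Implicit Types (x : X) (s : seq X) (S : {set X}) (c : {ffun {set X} -> int}).

Definition point_chain S : {ffun {set X} -> int} := [ffun T : {set X} => (T == S)%:R].

(* The iterated suspension with poles [x] and [a x]. *)
Fixpoint cross_polytope s : {ffun {set X} -> int} :=
  if s is x :: s' then cone x (cross_polytope s') - cone (a x) (cross_polytope s')
  else point_chain set0.

Lemma cone0 x : cone x 0 = 0.
Proof. by apply/ffunP => S; rewrite !ffunE mulr0 if_same. Qed.

(** Both cones over a cycle have that cycle as boundary, so their difference is closed. *)
Lemma boundary_cross_polytope s : boundary (cross_polytope s) = 0.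
Proof.
elim: s => [|x s IH] /=; last by rewrite boundaryB !boundary_cone IH !cone0 subr0 subrr.
apply/ffunP => t; rewrite boundaryE chain0E big1 // => v vt; rewrite ffunE.
case: eqVneq => [e|_]; last by rewrite mulr0.
by have := setU11 v t; rewrite e inE.
Qed.

Hypothesis aK : involutive a.

Definition no_opposite s := uniq s && all (fun x => a x \notin s) s.

Lemma no_opposite_cons x s : no_opposite (x :: s) ->
  [/\ no_opposite s, x \notin s, a x \notin s, a x != x & forall y, y \in s -> (a y != x) && (a y \notin s)].
Proof.
rewrite /no_opposite /= in_cons negb_or => /andP[/andP[xs us] /andP[/andP[ax axs] /allP h]].
have {}h y : y \in s -> (a y != x) && (a y \notin s) by move=> /h; rewrite in_cons negb_or.
split=> //; rewrite us; by apply/allP => y /h /andP[].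
Qed.

Lemma cone_supp x c S : cone x c S != 0 -> x \in S /\ c (S :\ x) != 0.
Proof. by rewrite ffunE; case: ifP; rewrite ?eqxx // mulf_eq0 negb_or => _ /andP[]. Qed.

Lemma cross_polytope_supp s S : no_opposite s -> cross_polytope s S != 0 ->
  [/\ #|S| = size s, forall y, y \in S -> (y \in s) || (a y \in s) & forall y, y \in S -> a y \notin S].
Proof.
elim: s S => [|x s IH] S /= hs.
  rewrite ffunE; case: (S =P set0) => [-> _|]; last by rewrite eqxx.
  by split=> [|y|y]; rewrite ?cards0 ?inE.
have [hs' xs axs ax hy] := no_opposite_cons hs.
move=> nz; have [p [pS cp pe]] : exists p, [/\ p \in S, cross_polytope s (S :\ p) != 0 & (p = x) \/ (p = a x)].
  move: nz; rewrite chainDE chainNE; have [->|/cone_supp[? ?] _] := eqVneq (cone x (cross_polytope s) S) 0.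
    by rewrite add0r oppr_eq0 => /cone_supp[? ?]; exists (a x); split=> //; right.
  by exists x; split=> //; left.
have [cS sub op] := IH _ hs' cp.
have px : (p == x) || (a p == x) by case: pe => ->; rewrite ?aK eqxx ?orbT.
have ps : (p \notin s) && (a p \notin s) by case: pe => ->; rewrite ?aK ?xs ?axs.
have ap : a p != p by case: pe => ->; rewrite ?aK // eq_sym.
have apS : a p \notin S.
  apply/negP => apS; have := sub (a p); rewrite !inE ap apS aK => /(_ isT).
  by case/andP: ps => /negPf -> /negPf ->.
split.
- by rewrite (cardsD1 p S) pS cS.
- move=> y yS; rewrite !in_cons; have [->|yp] := eqVneq y p.
    by case/orP: px => ->; rewrite ?orbT.
  by have := sub y; rewrite !inE yp yS => /(_ isT) /orP[]->; rewrite ?orbT.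
move=> y yS; have [-> //|yp] := eqVneq y p.
have [ayp|ayp] := eqVneq (a y) p; first by rewrite -ayp aK yS in apS.
by have := op y; rewrite !inE yp ayp yS => /(_ isT).
Qed.

(** On the facet of all first poles, the cone with apex [a x] vanishes at every stage. *)
Lemma cross_polytope_neq0 s : no_opposite s -> cross_polytope s [set x in s] != 0.
Proof.
elim: s => [|x s IH] hs /=.
  by rewrite ffunE (_ : [set _ in _] = set0) ?eqxx //; apply/setP => y; rewrite !inE.
have [hs' xs axs ax hy] := no_opposite_cons hs.
rewrite chainDE chainNE [X in _ - X]ffunE inE in_cons (negPf ax) (negPf axs) subr0 ffunE.
rewrite inE mem_head mulf_neq0 //; first by rewrite signr_eq0.
rewrite (_ : [set _ in _] :\ x = [set y in s]); first exact: IH.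
by apply/setP => y; rewrite !inE; have [->|_] := eqVneq y x; rewrite ?(negPf xs).
Qed.

End CrossPolytope.

(** * Degree of a chain over a cube *)

Section Degree.
Local Open Scope ring_scope.
Variable n : nat.
Implicit Types (x : cube n) (S t U : {set cube n}) (js : seq 'I_n) (c : {ffun {set cube n} -> int}).

Definition upper_sets (j : 'I_n) : {set {set cube n}} := [set S : {set cube n} | S \subset upper_half j].

(* A degree: it counts with multiplicity how often a chain covers the cube spanned by
   the directions [js], by iterating passage to the boundary facet [x j = 1]. *)
Fixpoint degree js c : int :=
  if js is j :: js' then degree js' (restrict (upper_sets j) (boundary c))
  else \sum_x c [set x].

Lemma eq_degree js b c : (0 < size js)%N -> boundary b = boundary c -> degree js b = degree js c.
Proof. by case: js => //= j js _ ->. Qed.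

Lemma restrictD F (b c : {ffun {set cube n} -> int}) : restrict F (b + c) = restrict F b + restrict F c.
Proof. by apply/ffunP => S; rewrite chainDE !restrictE chainDE; case: ifP; rewrite ?addr0. Qed.

Lemma degreeD js b c : degree js (b + c) = degree js b + degree js c.
Proof.
elim: js b c => [|j js IH] b c /=; last by rewrite boundaryD restrictD IH.
by rewrite -big_split; apply: eq_bigr => x _; rewrite chainDE.
Qed.

Lemma degree0 js : degree js 0 = 0.
Proof. by have := degreeD js 0 0; rewrite addr0; lia. Qed.

Lemma degree_boundary js c : degree js (boundary c) = 0.
Proof.
case: js => [|j js] /=.
  (* The sum over vertices is the augmentation, that is, the boundary coefficient at [set0]. *)
  transitivity (boundary (boundary c) set0); last by rewrite boundary_boundary chain0E.
  rewrite boundaryE; apply: eq_big => [x|x _]; first by rewrite inE.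
  rewrite setU0 (_ : face_sign set0 x = 1) ?mul1r // /face_sign (_ : [set _ in _ | _] = set0) ?cards0 //.
  by apply/setP => y; rewrite !inE.
rewrite boundary_boundary (_ : restrict _ 0 = 0) ?degree0 //.
by apply/ffunP => S; rewrite restrictE !chain0E if_same.
Qed.

(** Removing the part [c'] inside the upper half changes the facet only by a boundary. For the rest,
    a face in the facet arises by deleting the only lower vertex. Hence it is empty if the set was
    constant in direction [j], and otherwise it inherits the missing direction. *)
Lemma degree_degenerate js c :
  (forall S, c S != 0 -> S = set0 \/ exists2 i, i \in js & i \notin varying S) -> degree js c = 0.
Proof.
elim: js c => [|j js IH] c hc /=.
  rewrite big1 // => x _; apply/eqP/negPn/negP => /hc[/setP/(_ x)|[] //].
  by rewrite !inE eqxx.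
pose c' := restrict (upper_sets j) c.
have bc' : restrict (upper_sets j) (boundary c') = boundary c'.
  apply/ffunP => S; rewrite restrictE; case: ifPn => // nS.
  apply/esym/eqP/negPn/negP => /boundary_supp[v vS]; rewrite restrictE; case: ifP => [|_]; last by rewrite eqxx.
  by rewrite inE => /(subset_trans (subsetUr _ _)) sub; rewrite inE sub in nS.
rewrite -[c](subrK c') boundaryD restrictD degreeD bc' degree_boundary addr0.
apply: IH => S; rewrite restrictE; case: ifP => [|_]; last by rewrite eqxx.
rewrite inE => Sup /boundary_supp[v vS]; rewrite chainDE chainNE restrictE.
case: ifP => [_|/negbT]; first by rewrite subrr eqxx.
rewrite subr0 inE subUset Sup andbT sub1set inE => vj /hc[e|[i]].
  by have := setU11 v S; rewrite e inE.
rewrite in_cons => /predU1P[->|ijs] iv; last first.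
  right; exists i => //; apply: contraNN iv; apply/subsetP/varyingS/subsetUr.
left; apply/eqP; apply: contraNT iv => /set0Pn[x xS]; apply/varyingP; exists x, v.
split=> //; rewrite ?setU11 // ?inE ?xS ?orbT //.
by have := subsetP Sup x xS; rewrite inE.
Qed.

(** A chain [w] on the facet [x j = 1], given by induction, bounds some [b] in the acyclic family
    [spanning_upper]. The degree of [b] is that of [w]. The point with all coordinates in [js] equal
    to 1 keeps every iterated facet nonempty. *)
Lemma exists_degree js U : uniq js -> proj_closed js U ->
  (exists2 x, x \in U & {in js, forall j, x j}) ->
  exists c, [/\ on [set S : {set cube n} | S \subset U] (size js).+1 c,
    forall t, t \in spanning U js -> boundary c t = 0 & degree js c != 0].
Proof.
elim: js U => [|j js IH] U /=.
  move=> _ _ [x xU _]; exists (point_chain [set x]); split.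
  - move=> S; rewrite ffunE; case: (S =P [set x]) => [-> _|]; last by rewrite eqxx.
    by rewrite inE sub1set xU cards1.
  - move=> t /spanningP[[y yt] _ _]; rewrite boundaryE big1 // => v vt; rewrite ffunE.
    case: eqVneq => [e|_]; last by rewrite mulr0.
    have /set1P yx : y \in [set x] by rewrite -e inE yt orbT.
    have /set1P vx : v \in [set x] by rewrite -e setU11.
    by rewrite vx -yx yt in vt.
  rewrite (bigD1 x) //= big1 ?addr0; first by rewrite ffunE eqxx.
  by move=> y yx; rewrite ffunE (inj_eq set1_inj) (negPf yx).
case/andP=> jjs ujs cU [x xU xjs].
have [||w [wU wz wd]] := IH (U :&: upper_half j) ujs; first exact: proj_closed_upper.
  exists x; first by rewrite !inE xU xjs ?mem_head.
  by move=> i ijs; apply: xjs; rewrite inE ijs orbT.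
have [FE dis low] := spanning_upperE U j js.
have wH S : w S != 0 -> S \subset U :&: upper_half j by move=> /wU /andP[]; rewrite inE.
have up t v : t \in spanning_upper U j js -> v |: t \subset U -> v |: t \in spanning_upper U j js.
  rewrite inE => /andP[/spanningP[[y yt] tU vt] /exists_inP[z zt zj]] sub; have st := subsetUr [set v] t.
  rewrite inE; apply/andP; split; last by apply/exists_inP; exists z => //; apply: (subsetP st).
  apply/spanningP; split=> //; first by exists y; apply: (subsetP st).
  by move=> i /vt; apply/subsetP/varyingS.
have [||b bF be] := acyclic_spanning_upper (k := (size js).+1) jjs cU (z := restrict (spanning_upper U j js) w).
- exact: on_restrict wU.
- move=> t tF; transitivity (boundary w t).
    apply: eq_boundary_at => v vt; rewrite restrictE; case: ifPn => // nF.
    apply/esym/eqP/negPn/negP => /wH; rewrite subsetI => /andP[sub _].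
    by rewrite up in nF.
  move: (tF); rewrite FE inE => /orP[/wz //|tB].
  apply/eqP/negPn/negP => /boundary_supp[v vt /wH sub].
  move: tB => /spanningP[_ _ /(_ j (mem_head _ _)) /varyingP[_ [y [_ yt _]]]].
  by have := subsetP sub y; rewrite !inE yt orbT => /(_ isT) /andP[_ ->].
have bU S : b S != 0 -> S \subset U by move=> /bF /andP[]; rewrite inE => /andP[/spanningP[]].
exists b; split.
- by move=> S bS; have /andP[_ ->] := bF S bS; rewrite inE bU.
- move=> t tB; have tF : t \in spanning_upper U j js by rewrite FE inE tB orbT.
  rewrite be // restrictE tF; apply/eqP/negPn/negP => /wH sub.
  move: tB => /spanningP[_ _ /(_ j (mem_head _ _)) /varyingP[_ [y [_ yt _]]]].
  by have := subsetP sub y yt; rewrite !inE => /andP[_ ->].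
(* The facet part of the boundary of [b] agrees with [w] except on [set0] and on sets that miss a
   direction of [js], and those have degree zero. *)
set r := restrict _ _; rewrite -[r](subrK w) degreeD [X in X + _]degree_degenerate ?add0r // => S.
rewrite chainDE chainNE => rw; have [->|nS] := eqVneq S set0; [by left|right].
apply/exists_inP; apply: contraNT rw => /exists_inPn vS.
have [SU|SU] := boolP (S \subset U :&: upper_half j); last first.
  have w0 : w S = 0 by apply/eqP/negPn/negP => /wH; apply/negP.
  rewrite w0 subr0 restrictE; case: ifP => // Sup; apply/negPn/negP => /boundary_supp[v vt /bU].
  rewrite subUset => /andP[_ SU']; case/negP: SU; rewrite subsetI SU'.
  by move: Sup; rewrite inE.
have SF : S \in spanning_upper U j js.
  rewrite FE inE; apply/orP; left; apply/spanningP; split=> //; first exact/set0Pn.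
  by move=> i /vS; rewrite negbK.
move: SU; rewrite subsetI => /andP[_ Sup].
by rewrite /r restrictE inE Sup be // restrictE SF subrr.
Qed.

End Degree.

(** * The nonzero classes in degrees 7 and 4 *)

Section NonVanishing.
Local Open Scope ring_scope.
Variable n : nat.
Hypothesis n5 : (5 <= n)%N.
Implicit Types (S : {set cube n}).

Let zero : cube n := [ffun=> false].

Lemma homology7_nonzero : reduced_homology_nonzero (@hamming n) 3 7.
Proof.
pose D : {set 'I_n} := [set i : 'I_n | (i < 4)%N].
have D4 : #|D| = 4%N.
  rewrite (_ : D = [set widen_ord (ltnW n5) i | i : 'I_4]).
    by rewrite card_imset ?card_ord // => i k /(congr1 val) e; apply: val_inj.
  apply/setP => i; rewrite inE; apply/idP/imsetP => [i4|[k _ ->]]; last exact: ltn_ord k.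
  by exists (Ordinal i4) => //; apply: val_inj.
have /card_gt0P[j jD] : (0 < #|D|)%N by rewrite D4.
(* One pole from each of the eight antipodal pairs of a 4-subcube. *)
pose s := enum (subcube D zero :&: upper_half j).
have s8 : size s = 8%N by rewrite -cardE card_subcube_half // D4.
have sP x : (x \in s) = (x \in subcube D zero) && (x \in upper_half j) by rewrite mem_enum in_setI.
have hs : no_opposite (antipode D) s.
  rewrite /no_opposite enum_uniq; apply/allP => x; rewrite !sP => /andP[_ xj].
  by rewrite antipode_half // xj andbF.
pose z := cross_polytope (antipode D) s.
have zlow : on (low_cliques n) 8 z.
  move=> S /(cross_polytope_supp (@antipodeK _ D) hs)[cS sub op]; rewrite cS s8 eqxx andbT.
  have SU : S \subset subcube D zero.
    apply/subsetP => y /sub; rewrite !sP => /orP[]/andP[yU _] //.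
    by rewrite -[y](@antipodeK _ D) antipode_subcube.
  rewrite !inE (subcube_rips D4 SU); apply/andP; split.
    by rewrite -D4; apply/subset_leq_card/(varying_subcube SU).
  by apply/exists_inPn => y /op.
apply: (reduced_homology_nonzero_low zlow); first exact: boundary_cross_polytope.
(* As [z] is nonzero, a filling of it would contain a low clique [T] with nine points. *)
move=> b bl bz; have := cross_polytope_neq0 hs; rewrite -/z -bz => /boundary_supp[v vt /bl].
set T := v |: _; rewrite 2!inE => /andP[/andP[T4 rT] /eqP T9].
have TU := sub_subcube T; have le := leq_trans (subset_leq_card TU) (card_subcube _ _).
(* Nine points do not fit into a subcube of dimension 3. *)
have vT : #|varying T| = 4%N.
  move: T4 le; rewrite T9; case: (#|varying T|) => [|[|[|[|[|m]]]]] //.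
(* A clique is disjoint from its antipodal image, so together they would have 18 points in a cube of
   16. *)
pose E := antipode (varying T) @: T.
have dis : [disjoint T & E].
  rewrite disjoint_subset; apply/subsetP => x xT; rewrite inE; apply/imsetP => -[y yT xy].
  move: rT; rewrite (subcube_rips vT TU) => /exists_inPn /(_ y yT); by rewrite -xy xT.
have : (#|T :|: E| <= 16)%N.
  apply: leq_trans (_ : #|subcube (varying T) (corner T)| <= _)%N; last by have := card_subcube (varying T) (corner T); rewrite vT.
  apply: subset_leq_card; rewrite subUset TU; apply/subsetP => x /imsetP[y /(subsetP TU) yT ->].
  exact: antipode_subcube.
rewrite cardsU (_ : T :&: E = set0) ?cards0 ?subn0; last by apply/eqP; rewrite setI_eq0.
by rewrite card_imset ?T9 //; apply/can_inj/antipodeK.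
Qed.

Lemma homology4_nonzero : reduced_homology_nonzero (@hamming n) 3 4.
Proof.
pose js := [seq widen_ord n5 i | i <- enum 'I_5]; pose D := [set i in js].
have ujs : uniq js by rewrite map_inj_uniq ?enum_uniq // => i k /(congr1 val) e; apply: val_inj.
have sjs : size js = 5%N by rewrite size_map size_enum_ord.
have [||c [cU cz cd]] := exists_degree (js := js) (U := subcube D zero) ujs.
- move=> j x jjs /subcubeP xb; apply/subcubeP => i iD; rewrite ffunE xb //.
  by rewrite ffunE andbF.
- exists [ffun i => i \in D]; first by apply/subcubeP => i /negPf iD; rewrite !ffunE iD.
  by move=> i ijs; rewrite ffunE inE.
rewrite sjs in cU.
have low_degenerate S : S \in low_sets n -> exists2 i, i \in js & i \notin varying S.
  rewrite inE => S4; apply/exists_inP; apply: contraLR S4 => /exists_inPn h; rewrite -ltnNge -sjs.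
  rewrite -(card_uniqP ujs); apply/subset_leq_card/subsetP => i /h; by rewrite negbK.
have yl : on (low_sets n) 5 (boundary c).
  move=> S bS; have /boundary_supp[v vS /cU /andP[]] := bS.
  rewrite inE cardsU1 vS add1n eqSS subUset => /andP[_ SU] ->; rewrite andbT inE.
  have [S0|nS] := eqVneq S set0; first by rewrite S0 varying0 cards0.
  have /allPn[i ijs iv] : ~~ all (mem (varying S)) js.
    apply: contra_neqN bS => /allP vS'; apply: cz; apply/spanningP; split=> //; exact/set0Pn.
  rewrite -ltnS -sjs -(card_uniqP ujs); apply: proper_card; apply/properP; split; last by exists i.
  by apply/subsetP => k /(subsetP (varying_subcube SU)); rewrite inE.
have sub : {subset low_noncliques n <= low_sets n} by move=> S; rewrite inE => /andP[].
have lowE : low_sets n = low_cliques n :|: low_noncliques n.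
  by apply/setP => S; rewrite !inE -andb_orr orbN andbT.
(* The part of the boundary on non-cliques is a relative cycle; filling it by [g] pushes the cycle
   into the low cliques. *)
have [||g gl ge] := @acyclic_low_noncliques n 5 isT (restrict (low_noncliques n) (boundary c)).
- exact: on_restrict yl.
- move=> t tG; rewrite (boundary_restrict_upper lowE _ yl tG) ?boundary_boundary ?chain0E //.
  move=> S v; rewrite !inE => /andP[_ rS]; rewrite negb_and negbK; apply/orP; right.
  by apply: ripsS rS; apply: subD1set.
have zl : on (low_cliques n) 5 (boundary c - boundary g).
  move=> S; rewrite chainDE chainNE => zS.
  have [Sl S5] : S \in low_sets n /\ #|S| == 5%N.
    have [y0|/yl /andP[] //] := eqVneq (boundary c S) 0; move: zS; rewrite y0 add0r oppr_eq0.
    move=> /boundary_supp[v vS /gl /andP[]]; rewrite cardsU1 vS add1n eqSS => /sub; rewrite !inE => lt S5; split=> //.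
    by apply: leq_trans lt; apply/subset_leq_card/varyingS/subsetUr.
  rewrite S5 andbT; move: Sl; rewrite lowE inE => /orP[//|Sl].
  by rewrite ge // restrictE Sl subrr eqxx in zS.
apply: (reduced_homology_nonzero_low zl); first by rewrite boundaryB !boundary_boundary subr0.
move=> b bl bz; case/eqP: cd.
(* The chains [c] and [b + g] have the same boundary, hence the same degree; but [b + g] consists of
   low sets, each missing one of the five directions. *)
rewrite (@eq_degree _ _ _ (b + g)) ?sjs ?boundaryD ?bz ?subrK //.
apply: degree_degenerate => S; rewrite chainDE => bgS; right; apply: low_degenerate.
have [b0|/bl /andP[]] := eqVneq (b S) 0; last by rewrite inE => /andP[].
by move: bgS; rewrite b0 add0r => /gl /andP[/sub].
Qed.

End NonVanishing.

Theorem theorem1p2 (n : nat) : (5 <= n)%N ->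
  forall i : nat, reduced_homology_nonzero (@hamming n) 3 i <-> (i = 4%N \/ i = 7%N).
Proof.
move=> n5 i; split=> [h|[->|->]]; [|exact: homology4_nonzero|exact: homology7_nonzero].
have [->|i4] := eqVneq i 4%N; first by left.
have [->|i7] := eqVneq i 7%N; first by right.
(* Degree [i] means [i + 1] vertices, so the exceptional counts 5 and 8 are the degrees 4 and 7. *)
by case: (reduced_homology_vanishes _ h); apply: acyclic_cliques; rewrite eqSS.
Qed.
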